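(* Let $E=Exp(\mathbb{C})$ be the (LB)-space of entire functions of exponential type, and let $J:E\to E$ be the integration operator $Jf(z)=\int_0^zf(\zeta)\,d\zeta$. Every proper closed invariant subspace of $J$ on $E$ has the form $$A^E_K=\{f\in E:\ f^{(j)}(0)=0,\ 0\le j<K\}$$ for some $K\in\mathbb{N}$.
   Context: $\mathbb{N}=\{1,2,3,\dots\}$. $Exp(\mathbb{C})$ is the space of all entire functions $f$ for which there is $A>0$ with $\sup_{z\in\mathbb{C}}|f(z)|e^{-A|z|}<\infty$, endowed with the inductive limit topology, i.e. the finest locally convex topology for which the inclusions of the Banach spaces $\{f \text{ entire}:\sup_z|f(z)|e^{-n|z|}<\infty\}$, $n\in\mathbb{N}$ (normed by the indicated supremum), are continuous. The operator $J$ is continuous on $Exp(\mathbb{C})$. A subspace $M$ of a locally convex space $E$ is proper if $\{0\}\ne M\ne E$, and is invariant for a continuous linear operator $T:E\to E$ if $T(M)\subset M$. *)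

(* Defs.v *)
From HB Require Import structures.
From mathcomp Require Import all_boot all_order all_algebra.
From mathcomp Require Import complex.
From mathcomp Require Import all_classical all_reals all_analysis.

Set Implicit Arguments.
Unset Strict Implicit.
Unset Printing Implicit Defensive.

Import Order.TTheory GRing.Theory Num.Theory.
Import numFieldNormedType.Exports.
Import Normc.

Local Open Scope classical_set_scope.
Local Open Scope complex_scope.
Local Open Scope ring_scope.

(* The finest locally convex topology on E making all the j n continuous, as a
   family of open sets. A locally convex topology on E is presented by a tvsType
   F together with a linear bijection i : E -> F, its open sets being the
   preimages by i of the open sets of F. The open sets below are the union of
   all the admissible topologies; when the j n jointly cover E, indlim_openE and
   the instances built on it show that this union is itself admissible. *)
Definition indlim_open (K : numFieldType) (E : lmodType K)
    (S : nat -> normedModType K) (j : forall n, {linear S n -> E})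
    (U : set E) : Prop :=
  exists (F : tvsType K) (i : {linear E -> F}),
    [/\ bijective i, forall n, continuous (i \o j n)
      & exists2 V : set F, open V & U = i @^-1` V].

(* Neighborhood bases of 0 made of absolutely convex sets; they serve to prove
   that indlim_open is a locally convex topology. *)
Definition absconvex (K : numFieldType) (E : lmodType K) (V : set E) :=
  forall (a b : K) x y, `|a| + `|b| <= 1 -> V x -> V y -> V (a *: x + b *: y).

Record disk_base (K : numFieldType) (E : lmodType K) (B : set (set E)) : Prop :=
  DiskBase {
    disk_baseT : B setT ;
    disk_baseP : forall V, B V -> absconvex V ;
    disk_baseI : forall V W, B V -> B W -> B (V `&` W) ;
    disk_base_absorb : forall V, B V -> forall x, exists2 r, r != 0 & V (r *: x) ;
    disk_baseZ : forall V r, B V -> r != 0 -> B [set x | V (r *: x)] }.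

Definition disk_open (K : numFieldType) (E : lmodType K) (B : set (set E))
    (U : set E) :=
  forall x, U x -> exists2 V, B V & forall v, V v -> U (x + v).

Section disk_base.
Context (K : numFieldType) (E : lmodType K) (B : set (set E)).
Hypothesis hB : disk_base B.

Let half1 : `|2^-1 : K| + `|2^-1| <= 1.
Proof. by rewrite normfV ger0_norm ?ler0n// -[2^-1]mul1r -splitr. Qed.

Lemma disk_base0 V : B V -> V 0.
Proof.
move=> BV; have [r _ Vr] := disk_base_absorb hB BV 0.
have := disk_baseP hB BV _ Vr Vr; move=> /(_ 0 0).
by rewrite !scale0r addr0; apply; rewrite normr0 addr0 ler01.
Qed.

Lemma disk_half V : B V -> exists2 W, B W & forall v w, W v -> W w -> V (v + w).
Proof.
move=> BV; exists [set x | V (2 *: x)].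
  by apply: (disk_baseZ hB) => //; rewrite pnatr_eq0.
move=> v w /= Vv Vw.
have := disk_baseP hB BV half1 Vv Vw.
by rewrite !scalerA mulVf ?pnatr_eq0// !scale1r.
Qed.

Lemma disk_openT : disk_open B setT.
Proof. by move=> x _; exists setT => //; exact: disk_baseT. Qed.

Lemma disk_openI : setI_closed (disk_open B).
Proof.
move=> U V oU oV x [/oU[U' BU' UU'] /oV[V' BV' VV']].
exists (U' `&` V'); first exact: disk_baseI.
by move=> v [? ?]; split; [exact: UU'|exact: VV'].
Qed.

Lemma disk_open_bigU (I : Type) (f : I -> set E) :
  (forall i, disk_open B (f i)) -> disk_open B (\bigcup_i f i).
Proof.
move=> of_ x [i _ /of_[V BV Vf]]; exists V => // v /Vf ?; by exists i.
Qed.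

Lemma disk_nbhs x U :
  (exists A, [/\ disk_open B A, A x & A `<=` U]) <->
  exists2 V, B V & forall v, V v -> U (x + v).
Proof.
split=> [[A [oA /oA[V BV VA] AU]]|[V BV VU]].
  by exists V => // v /VA /AU.
exists [set y | exists2 W, B W & forall w, W w -> U (y + w)]; split.
- move=> y /= [W BW WU]; have [W' BW' W'W] := disk_half BW.
  exists W' => // v W'v; exists W' => // w W'w.
  by rewrite -addrA; apply: WU; exact: W'W.
- by exists V.
- by move=> y [W BW WU]; rewrite -(addr0 y); by apply: WU; exact: disk_base0.
Qed.

End disk_base.

Lemma scale_split (K : fieldType) (E : lmodType K) (a b c r : K) (x p : E) :
  c != 0 -> r != 0 ->
  b *: p = a *: x + ((b / c) *: (c *: (p - x)) + ((b - a) / r) *: (r *: x)).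
Proof.
move=> c0 r0; rewrite !scalerA !divfK// scalerBr scalerBl.
by rewrite [X in _ + X]addrA addrA (subrK (b *: x)) addrC addKr.
Qed.

Lemma conv_split (K : numDomainType) (E : lmodType K) (l : {i01 K})
    (x y z v : E) :
  (conv l (y : convex_lmodType E) (z : convex_lmodType E) : E) + v - x =
  l%:num *: (y + v - x) + (1 - l%:num) *: (z + v - x).
Proof.
rewrite -!addrA !(scalerDr _ _ (v - x)) addrACA -scalerDl.
by rewrite [l%:num + _]addrC subrK scale1r addrA.
Qed.

Section disk_base_tvs.
Context (K : numFieldType) (T : preTopologicalLmodType K) (B : set (set T)).
Hypothesis hB : disk_base B.
Hypothesis nbT : forall (x : T) U,
  nbhs x U <-> exists2 V, B V & forall v, V v -> U (x + v).

Lemma disk_add_continuous : continuous (fun x : T * T => x.1 + x.2).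
Proof.
move=> [x y] U /= /nbT[V BV VU]; have [W BW WV] := disk_half hB BV.
exists ([set p | W (p - x)], [set p | W (p - y)]).
  by split; apply/nbT; exists W => // v Wv /=; rewrite addrC addKr.
move=> [p q] /= [Wp Wq].
have -> : p + q = x + y + ((p - x) + (q - y)).
  by rewrite addrACA !(addrC _ (- _)) !addNKr.
exact/VU/WV.
Qed.

Lemma disk_scale_continuous : continuous (fun z : K^o * T => z.1 *: z.2).
Proof.
move=> [a x] U /= /nbT[V BV VU].
have [r r0 Vr] := disk_base_absorb hB BV x.
pose c : K := 2 * (`|a| + 1).
have c0 : 0 < c by rewrite mulr_gt0// ltr_wpDl.
have nb (e : K) : 0 < e -> nbhs (a : K^o) [set b : K^o | `|a - b| < e].
  by move=> e0; apply/nbhs_ballP; exists e => //= b; rewrite -ball_normE.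
exists ([set b : K^o | `|a - b| < 1] `&` [set b : K^o | `|a - b| < `|r| / 2],
        [set p | V (c *: (p - x))]).
  split => /=.
    by apply: filterI; apply: nb => //; rewrite divr_gt0 ?normr_gt0.
  apply/nbT; exists [set v | V (c *: v)].
    by apply: (disk_baseZ hB BV); rewrite gt_eqF.
  by move=> v Vv /=; rewrite addrC addKr.
move=> [b p] /= [[ab1 abr] Vp].
have cn0 : c != 0 by rewrite gt_eqF.
rewrite [X in U X](scale_split a b x p cn0 r0).
apply: VU; apply: (disk_baseP hB BV) => //.
rewrite [leRHS](splitr 1) lerD//.
  rewrite normrM normfV (gtr0_norm c0) ler_pdivrMr// /c mul1r mulKf ?pnatr_eq0//.
  rewrite -[b](subrK a) (le_trans (ler_normD _ _))// addrC lerD2l distrC.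
  exact: ltW.
rewrite normrM normfV ler_pdivrMr ?normr_gt0// mulrC distrC mul1r.
by rewrite ltW.
Qed.

Lemma disk_locally_convex :
  exists2 A : set_system T, (forall b, b \in A -> convex_set b) & basis A.
Proof.
exists [set U | open U /\ convex_set U]; first by move=> b; rewrite inE => -[].
split; first by move=> b [].
move=> x U /nbT[V BV VU] /=.
pose S : set T := [set z | V (z - x)].
have SU : S `<=` U by move=> z /VU; rewrite addrC subrK.
exists S^°; last by move=> z /interior_subset /SU.
split; last first.
  by apply/nbT; exists V => // v; rewrite /S/= addrC addKr.
split; first exact: open_interior.
move=> y z l; rewrite !inE /interior => /nbT[W1 BW1 W1S] /nbT[W2 BW2 W2S].
apply/nbT; exists (W1 `&` W2); first exact: disk_baseI.
move=> v [/W1S + /W2S]; rewrite /S/= => Vy Vz.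
have := disk_baseP hB BV _ Vy Vz => /(_ l%:num (1 - l%:num)).
rewrite -(@conv_split K T); apply.
by rewrite !ger0_norm ?subr_ge0// addrC subrK.
Qed.

End disk_base_tvs.

Definition disk_space (K : numFieldType) (E : lmodType K) (B : set (set E))
  (hB : disk_base B) : Type := E.

Section disk_space.
Context (K : numFieldType) (E : lmodType K) (B : set (set E)).
Context (hB : disk_base B).
Local Notation T := (disk_space hB).
HB.instance Definition _ := GRing.Lmodule.on T.
HB.instance Definition _ := isOpenTopological.Build T
  (disk_openT hB) (disk_openI hB) (@disk_open_bigU _ _ B).
Lemma disk_space_nbhs (x : T) U :
  nbhs x U <-> exists2 V, B V & forall v, V v -> U (x + v).
Proof.
rewrite nbhsE; apply: iff_trans (disk_nbhs hB x U).
by split=> -[A]; [move=> [oA Ax] AU | move=> [oA Ax AU]]; exists A.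
Qed.
Let hBT : @disk_base K T B. Proof. by case: hB => *; split. Qed.
HB.instance Definition _ := PreTopologicalLmod_isTvs.Build K T
  (@disk_add_continuous K T B hBT disk_space_nbhs)
  (@disk_scale_continuous K T B hBT disk_space_nbhs)
  (@disk_locally_convex K T B hBT disk_space_nbhs).
HB.instance Definition _ := PreTopologicalNmodule_isTopologicalNmodule.Build T
  (@disk_add_continuous K T B hBT disk_space_nbhs).
HB.instance Definition _ := TopologicalNmodule_isTopologicalLmodule.Build K T
  (@disk_scale_continuous K T B hBT disk_space_nbhs).
HB.instance Definition _ := Uniform_isTvs.Build K T
  (@disk_locally_convex K T B hBT disk_space_nbhs).

End disk_space.

Section absconvex.
Context (K : numFieldType) (E : lmodType K).

Lemma absconvexW (V : set E) :
    (forall t x y, 0 <= t -> t <= 1 -> V x -> V y ->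
      V (t *: x + (1 - t) *: y)) ->
    (forall a x, `|a| <= 1 -> V x -> V (a *: x)) ->
  absconvex V.
Proof.
move=> cV bV a b x y ab Vx Vy.
have [a0|a0] := eqVneq a 0.
  by rewrite a0 scale0r add0r; apply: bV => //; move: ab; rewrite a0 normr0 add0r.
have [b0|b0] := eqVneq b 0.
  by rewrite b0 scale0r addr0; apply: bV => //; move: ab; rewrite b0 normr0 addr0.
have na0 : `|a| != 0 by rewrite normr_eq0.
have nb0 : `|b| != 0 by rewrite normr_eq0.
pose s := `|a| + `|b|.
have s_gt0 : 0 < s by rewrite addr_gt0// normr_gt0.
have s0 : s != 0 by rewrite gt_eqF.
have E1 : 1 - `|a| / s = `|b| / s.
  by rewrite -{1}(divff s0) -mulrBl /s [`|a| + _]addrC addrK.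
have := cV (`|a| / s) ((s / `|a| * a) *: x) ((s / `|b| * b) *: y).
have -> : (`|a| / s) *: ((s / `|a| * a) *: x) = a *: x.
  by rewrite scalerA !mulrA divfK// mulfV// mul1r.
rewrite E1.
have -> : (`|b| / s) *: ((s / `|b| * b) *: y) = b *: y.
  by rewrite scalerA !mulrA divfK// mulfV// mul1r.
apply.
- by rewrite divr_ge0// ltW.
- by rewrite ler_pdivrMr// mul1r lerDl.
- by apply: bV => //; rewrite !normrM normfV normr_id divfK// ger0_norm// ltW.
- by apply: bV => //; rewrite !normrM normfV normr_id divfK// ger0_norm// ltW.
Qed.

End absconvex.

Section inductive_limit.
Context (K : numFieldType) (E : lmodType K).
Context (S : nat -> normedModType K) (j : forall n, {linear S n -> E}).

Definition indlim_base (V : set E) :=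
  absconvex V /\ forall n, nbhs (0 : S n) (j n @^-1` V).

Hypothesis jE : forall x : E, exists n s, x = j n s.

Let nbhs0E n (U : set (S n)) :
  nbhs (0 : S n) U <-> exists2 e, 0 < e & forall s, `|s| < e -> U s.
Proof.
split=> [/nbhs_ballP[e /= e0 eU]|[e e0 eU]].
  by exists e => // s se; apply: eU; rewrite -ball_normE /= sub0r normrN.
by apply/nbhs_ballP; exists e => // s; rewrite -ball_normE /= sub0r normrN => /eU.
Qed.

Lemma indlim_baseP : disk_base indlim_base.
Proof.
split.
- by split=> // n; exact: filterT.
- by move=> V [].
- move=> V W [aV nV] [aW nW]; split=> [a b x y ab [Vx Wx] [Vy Wy]|n].
    by split; [exact: aV|exact: aW].
  exact: filterI.
- move=> V [_ nV] x; have [n [s ->]] := jE x.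
  have /nbhs0E[e e0 eV] := nV n.
  have s1 : 0 < `|s| + 1 by rewrite ltr_wpDl.
  exists (e / (`|s| + 1)); first by rewrite mulf_neq0 ?invr_eq0 ?gt_eqF.
  rewrite -linearZ; apply: eV.
  rewrite normrZ normrM normfV !gtr0_norm// -mulrA gtr_pMr//.
  by rewrite mulrC ltr_pdivrMr// mul1r ltrDl.
- move=> V r [aV nV] r0; split=> [a b x y ab /= Vx Vy|n].
    by rewrite scalerDr !scalerA ![r * _]mulrC -!scalerA; exact: aV.
  have /nbhs0E[e e0 eV] := nV n; apply/nbhs0E.
  exists (e / `|r|) => [|s se]; first by rewrite divr_gt0 ?normr_gt0.
  rewrite /= -linearZ; apply: eV.
  by rewrite normrZ mulrC -ltr_pdivlMr ?normr_gt0.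
Qed.

Let incl (x : E) : disk_space indlim_baseP := x.

Let incl_linear : linear incl. Proof. by []. Qed.

HB.instance Definition _ := GRing.isLinear.Build K E (disk_space indlim_baseP) _
  incl incl_linear.

Let incl_continuous n : continuous (incl \o j n).
Proof.
move=> s U /= /disk_space_nbhs[V [aV nV] VU].
have /nbhs0E[e e0 eV] := nV n.
apply/nbhs_ballP; exists e => // t; rewrite -ball_normE /= => st.
have -> : j n t = j n s + j n (t - s) by rewrite -linearD addrC subrK.
by apply/VU/eV; rewrite distrC.
Qed.

Lemma indlim_openE : indlim_open j = disk_open indlim_base.
Proof.
apply/funext => U; apply/propext; split; last first.
  move=> oU; exists (disk_space indlim_baseP : tvsType K), incl; split.
  - by exists id.
  - exact: incl_continuous.
  - by exists U.
move=> [F [i [_ ci [V oV ->]]]] x /= Vx.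
have nV : nbhs (0 : F) [set v | V (i x + v)].
  have /(_ V) := @add_continuous F (i x, 0).
  rewrite /= addr0 => /(_ (open_nbhs_nbhs (conj oV Vx))).
  case=> -[P Q] /= [Px Q0] PQ; apply: filterS Q0 => v Qv.
  by apply: (PQ (i x, v)); split=> //=; exact: nbhs_singleton.
have [A Acvx [Aop /(_ 0 _ nV)[W /= [AW W0] WV]]] := @locally_convex K F.
have cW t (v w : F) : 0 <= t -> t <= 1 -> W v -> W w ->
    W (t *: v + (1 - t) *: w).
  move=> t0 t1 Wv Ww.
  have := Acvx W (mem_set AW) v w (Itv01 t0 t1).
  by rewrite !inE; apply.
exists [set v | forall a : K, `|a| <= 1 -> W (a *: i v)]; last first.
  by move=> v /(_ 1); rewrite normr1 scale1r linearD => /(_ (lexx _)) /WV.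
split.
  apply: absconvexW => [t v w t0 t1 /= Wv Ww a a1|a v a1 /= Wv b b1].
    rewrite linearD !linearZ scalerDr !scalerA ![a * _]mulrC -!scalerA.
    by apply: cW => //; [exact: Wv|exact: Ww].
  by rewrite linearZ scalerA; apply: Wv; rewrite normrM mulr_ile1.
move=> n.
have nW : nbhs ((i \o j n) 0) W.
  by rewrite /= !linear0; apply: open_nbhs_nbhs; split=> //; exact: Aop.
have /nbhs0E[e e0 eW] := ci n 0 W nW.
apply/nbhs0E; exists e => // s se a a1 /=.
rewrite -!linearZ; apply: eW; rewrite normrZ.
by rewrite (le_lt_trans _ se)// ler_piMl.
Qed.

End inductive_limit.

Section entire_functions.
Context {R : realType}.
Local Notation C := (R[i]^o).
Implicit Types (f g : C -> C) (A : R).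

(* derivable over the field R[i]: complex differentiability *)
Definition entire f := forall z : C, derivable f z 1.

Definition weighted A f (z : C) : R := normc (f z) * expR (- (A * normc z)).

Definition exp_bounded A f := has_ubound (range (weighted A f)).

Definition exp_type_pred : {pred C -> C} :=
  [pred f | `[< entire f /\ exists2 A, 0 < A & exp_bounded A f >]].

Definition exp_step_pred (n : nat) : {pred C -> C} :=
  [pred f | `[< entire f /\ exp_bounded n.+1%:R f >]].

Lemma normc_ge0 (z : C) : 0 <= normc z.
Proof. by case: z => a b; exact: sqrtr_ge0. Qed.

Lemma weighted_ge0 A f z : 0 <= weighted A f z.
Proof. by rewrite mulr_ge0 ?expR_ge0 ?normc_ge0. Qed.

Lemma weightedD A f g z :
  weighted A (f + g) z <= weighted A f z + weighted A g z.
Proof. by rewrite -mulrDl ler_wpM2r ?expR_ge0//; exact: le_normcD. Qed.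

Lemma weightedZ A (a : C) f z :
  weighted A (a *: f) z = normc a * weighted A f z.
Proof. by rewrite /weighted normcM mulrA. Qed.

Lemma le_weighted A B f z : A <= B -> weighted B f z <= weighted A f z.
Proof.
move=> AB; rewrite ler_wpM2l ?normc_ge0// ler_expR lerN2.
by rewrite ler_wpM2r ?normc_ge0.
Qed.

Lemma exp_bounded_mono A B f : A <= B -> exp_bounded A f -> exp_bounded B f.
Proof.
move=> AB [u uf]; exists u => _ [z _ <-].
by rewrite (le_trans (le_weighted _ _ AB))//; apply: uf; exists z.
Qed.

Lemma exp_bounded_lin A (a : C) f g :
  exp_bounded A f -> exp_bounded A g -> exp_bounded A (a *: f + g).
Proof.
move=> [u uf] [v vg]; exists (normc a * u + v) => _ [z _ <-].
rewrite (le_trans (weightedD _ _ _ _))// weightedZ lerD//.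
  by rewrite ler_wpM2l ?normc_ge0//; apply: uf; exists z.
by apply: vg; exists z.
Qed.

Lemma exp_bounded0 A : exp_bounded A (0 : C -> C).
Proof. by exists 0 => _ [z _ <-]; rewrite /weighted normc0 mul0r. Qed.

Lemma entire0 : entire (0 : C -> C).
Proof. by move=> z; exact: derivable_cst. Qed.

Lemma entire_lin (a : C) f g : entire f -> entire g -> entire (a *: f + g).
Proof.
by move=> hf hg z; apply: derivableD (hg z); exact: (@derivableZ _ _ _ f a).
Qed.

Lemma exp_type_submod_closed : submod_closed exp_type_pred.
Proof.
split; first by apply/asboolP; split; [exact: entire0|exists 1 => //; exact: exp_bounded0].
move=> a f g /asboolP[ef [A A0 bf]] /asboolP[eg [B B0 bg]].
apply/asboolP; split; first exact: entire_lin.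
exists (A + B); first exact: addr_gt0.
apply: exp_bounded_lin.
  by apply: exp_bounded_mono bf; rewrite lerDl ltW.
by apply: exp_bounded_mono bg; rewrite lerDr ltW.
Qed.

Lemma exp_step_submod_closed n : submod_closed (exp_step_pred n).
Proof.
split; first by apply/asboolP; split; [exact: entire0|exact: exp_bounded0].
move=> a f g /asboolP[ef bf] /asboolP[eg bg].
by apply/asboolP; split; [exact: entire_lin|exact: exp_bounded_lin].
Qed.

HB.instance Definition _ := GRing.isSubmodClosed.Build R[i] (C -> C)
  exp_type_pred exp_type_submod_closed.
HB.instance Definition _ n := GRing.isSubmodClosed.Build R[i] (C -> C)
  (exp_step_pred n) (exp_step_submod_closed n).

End entire_functions.

Section expC.
Variable R : realType.
Local Notation C := (R[i]^o).

Definition expC : Type := {f : C -> C | f \in exp_type_pred}.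
HB.instance Definition _ := SubType.on expC.
HB.instance Definition _ := Choice.on expC.
HB.instance Definition _ := [SubChoice_isSubLmodule of expC by <:].

(* The n-th step has weight n + 1, so that the weights range over 1, 2, ... *)
Definition expC_step (n : nat) : Type := {f : C -> C | f \in exp_step_pred n}.
HB.instance Definition _ n := SubType.on (expC_step n).
HB.instance Definition _ n := Choice.on (expC_step n).
HB.instance Definition _ n := [SubChoice_isSubLmodule of expC_step n by <:].

Section step_norm.
Variable n : nat.
Implicit Types f g : expC_step n.

Definition step_sup f : R := sup (range (weighted n.+1%:R (val f))).

(* the norm of a normedModType over R[i] takes its values in R[i] *)
Definition step_norm f : R[i] := (step_sup f)%:C.

Lemma step_sup_ub f z : weighted n.+1%:R (val f) z <= step_sup f.
Proof.
have /asboolP[_ bf] := valP f.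
by apply: ub_le_sup => //; exists z.
Qed.

Lemma step_sup_le f u :
  (forall z, weighted n.+1%:R (val f) z <= u) -> step_sup f <= u.
Proof.
move=> fu; apply: ge_sup; first by exists (weighted n.+1%:R (val f) 0), 0.
by move=> _ [z _ <-].
Qed.

Lemma step_supD f g : step_sup (f + g) <= step_sup f + step_sup g.
Proof.
apply: step_sup_le => z; rewrite raddfD (le_trans (weightedD _ _ _ _))//.
by rewrite lerD ?step_sup_ub.
Qed.

Lemma step_supZ_le (a : C) f : step_sup (a *: f) <= normc a * step_sup f.
Proof.
apply: step_sup_le => z; rewrite linearZ weightedZ.
by rewrite ler_wpM2l ?normc_ge0 ?step_sup_ub.
Qed.

Lemma step_sup_ge0 f : 0 <= step_sup f.
Proof. exact: le_trans (weighted_ge0 _ _ 0) (step_sup_ub f 0). Qed.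

Lemma step_normD f g : step_norm (f + g) <= step_norm f + step_norm g.
Proof. by rewrite /step_norm -rmorphD/= lecR step_supD. Qed.

Lemma step_normZ (a : R[i]) f : step_norm (a *: f) = `|a| * step_norm f.
Proof.
have -> : `|a| = (normc a)%:C by [].
rewrite /step_norm -rmorphM/=; congr (_%:C); apply/eqP.
rewrite eq_le step_supZ_le/=.
have [->|a0] := eqVneq a 0; first by rewrite normc0 mul0r step_sup_ge0.
have na0 : 0 < normc a.
  by rewrite lt_neqAle normc_ge0 andbT eq_sym; apply: contra a0 => /eqP/eq0_normc ->.
have := step_supZ_le a^-1 (a *: f).
by rewrite scalerA mulVf// scale1r normcV mulrC -ler_pdivrMr ?invr_gt0// invrK mulrC.
Qed.

Lemma step_norm0_eq0 f : step_norm f = 0 -> f = 0.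
Proof.
move=> [f0]; apply/val_inj/funext => z; apply: eq0_normc.
apply/eqP; rewrite eq_le normc_ge0 andbT.
have := step_sup_ub f z; rewrite /step_sup in f0 *; rewrite f0 /weighted.
by rewrite pmulr_lle0 ?expR_gt0.
Qed.

HB.instance Definition _ := Lmodule_isNormed.Build R[i] (expC_step n)
  step_normD step_normZ step_norm0_eq0.

Lemma step_exp_type f : val f \in exp_type_pred.
Proof.
have /asboolP[ef bf] := valP f.
by apply/asboolP; split => //; exists n.+1%:R => //; rewrite ltr0n.
Qed.

Definition step_incl f : expC := Sub (val f) (step_exp_type f).

Lemma step_incl_linear : linear step_incl.
Proof. by move=> a f g; apply/val_inj. Qed.

HB.instance Definition _ := GRing.isLinear.Build R[i] (expC_step n) expC _
  step_incl step_incl_linear.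

End step_norm.

Lemma step_incl_cover (x : expC) : exists n s, x = step_incl (n := n) s.
Proof.
have /asboolP[ef [A A0 bf]] := valP x.
pose n := Num.truncn A.
have xn : val x \in exp_step_pred n.
  apply/asboolP; split => //; apply: exp_bounded_mono bf.
  exact/ltW/truncnS_gt.
by exists n, (Sub (val x) xn); apply/val_inj.
Qed.

Let incl n : {linear expC_step n -> expC} := @step_incl n.
Let base := indlim_base incl.

Lemma expC_disk_base : disk_base base.
Proof. exact/indlim_baseP/step_incl_cover. Qed.

Definition expC_open : set (set expC) := indlim_open incl.

Lemma expC_openE : expC_open = disk_open base.
Proof. exact/indlim_openE/step_incl_cover. Qed.

Lemma expC_openT : expC_open setT.
Proof. by rewrite expC_openE; exact/disk_openT/expC_disk_base. Qed.

Lemma expC_openI : setI_closed expC_open.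
Proof. by rewrite expC_openE; exact/disk_openI/expC_disk_base. Qed.

Lemma expC_open_bigU (I : Type) (f : I -> set expC) :
  (forall i, expC_open (f i)) -> expC_open (\bigcup_i f i).
Proof. by rewrite expC_openE; exact: disk_open_bigU. Qed.

HB.instance Definition _ := isOpenTopological.Build expC
  expC_openT expC_openI expC_open_bigU.

Lemma expC_nbhs (x : expC) U :
  nbhs x U <-> exists2 V, base V & forall v, V v -> U (x + v).
Proof.
rewrite nbhsE; apply: iff_trans (disk_nbhs expC_disk_base x U).
rewrite -expC_openE.
by split=> -[A]; [move=> [oA Ax] AU | move=> [oA Ax AU]]; exists A.
Qed.

Let hB : @disk_base R[i] expC base.
Proof. by case: expC_disk_base => *; split. Qed.

HB.instance Definition _ := PreTopologicalLmod_isTvs.Build R[i] expC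
  (disk_add_continuous hB expC_nbhs)
  (disk_scale_continuous hB expC_nbhs)
  (disk_locally_convex hB expC_nbhs).
HB.instance Definition _ := PreTopologicalNmodule_isTopologicalNmodule.Build
  expC (disk_add_continuous hB expC_nbhs).
HB.instance Definition _ := TopologicalNmodule_isTopologicalLmodule.Build
  R[i] expC (disk_scale_continuous hB expC_nbhs).
HB.instance Definition _ := Uniform_isTvs.Build R[i] expC
  (disk_locally_convex hB expC_nbhs).

Lemma expC_openP (U : set expC) : open U <-> expC_open U.
Proof. by []. Qed.

(* expC is a locally convex space whose topology makes the inclusions of the
   steps continuous and is the finest such. *)
Lemma step_incl_continuous n : continuous (@step_incl n).
Proof.
move=> f U /= /expC_nbhs[V [_ nV] VU].
have /nbhs_ballP[e /= e0 eV] := nV n.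
apply/nbhs_ballP; exists e => // g; rewrite -ball_normE /= => fg.
have -> : step_incl g = step_incl f + step_incl (g - f).
  by rewrite -linearD addrC subrK.
by apply/VU/eV; rewrite -ball_normE /= sub0r normrN distrC.
Qed.

Lemma expC_finest (F : tvsType R[i]) (i : {linear expC -> F}) :
  bijective i -> (forall n, continuous (i \o @step_incl n)) -> continuous i.
Proof.
move=> bi ci; apply/continuousP => V oV; apply/expC_openP.
by exists F, i; split => //; exists V.
Qed.

End expC.

Section integration_operator.
Context {R : realType}.
Local Notation C := (R[i]^o).

(* the path integral of f along the segment t |-> a + t (b - a) *)
Definition segment_integral (f : C -> C) (a b : C) : C :=
  let g (t : R) : R[i] := f (a + t%:C * (b - a)) * (b - a) in
  (\int[lebesgue_measure]_(t in `[0, 1]) complex.Re (g t)) +i*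
  (\int[lebesgue_measure]_(t in `[0, 1]) complex.Im (g t)).

Definition integration_op (f : C -> C) : C -> C :=
  fun z => segment_integral f 0 z.

(* J(M) is contained in M, both being read as sets of functions *)
Definition integration_invariant (M : set (expC R)) :=
  [set integration_op (val f) | f in M] `<=` [set val f | f in M].

Definition proper_subspace (M : set (expC R)) :=
  [/\ submod_closed (mem M), M <> [set 0] & M <> setT].

Definition vanishing_subspace (K : nat) : set (expC R) :=
  [set f | forall j, (j < K)%N -> derive1n j (val f : C -> C) 0 = 0].

End integration_operator.

(* Main.v *)
(* Write f = sum a_n z^n / n!. Exponential type means |a_n| <= A D^n, i.e. that the
   Borel transform sum a_n x^n is a germ of holomorphic function at 0, and J is
   multiplication by x on these germs. If K is the least order of vanishing at 0
   among the elements of M, attained at f, then the germ of f is x^K times a unit, so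
   the germ of any h in A_K is a power series times the germ of f: dividing step by
   step, h = sum_(m < N) p_m J^m f + r_N, and the geometric bounds on coefficients
   survive the division and give |r_N(z)| <= b 2^-N exp(Q |z|), whence h is in the
   closure of M.
   That an entire function has such an expansion is Cauchy's theory, done here on
   rectangles: Goursat's lemma by bisection, then the Cauchy formula on the squares
   [-r, r]^2. *)

Require Import Defs.
From mathcomp Require Import all_boot all_order all_algebra.
From mathcomp Require Import complex ring lra.
From mathcomp Require Import all_classical all_reals all_analysis.

Import Order.TTheory GRing.Theory Num.Theory.
Import numFieldNormedType.Exports.
Import Normc.

Local Open Scope classical_set_scope.
Local Open Scope complex_scope.
Local Open Scope ring_scope.

Set Implicit Arguments.
Unset Strict Implicit.
Unset Printing Implicit Defensive.

(** Division by the unit is not free: the bound on the coefficients of r_N picks up a factor (1 +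
    [al]) D at each step, where [al] compares the coefficients of f with its leading one. What saves
    the argument is that r_N starts at order K + N: measured against Q^n with Q = 2 (1 + [al]) D, a
    coefficient of index n >= K + N gains Q^N, which beats that growth by 2^N. Since Q does not
    depend on N, all remainders lie in a single Banach step and tend to 0 there, so the inductive
    limit topology enters only through the trace of a neighborhood on one step. The spaces A_K are
    defined by iterated derivatives and J by a Lebesgue integral. Both are brought to coefficients
    by termwise differentiation and integration under the majorant A exp(D |z|), and uniqueness of
    the coefficients carries the identities over. Squares are convenient because their sides reduce
    boundary integrals to real integrals over segments. That |z| varies on the boundary between r
    and 2 r costs only a geometric factor, which a bound of the form A D^n absorbs. *)

Section complex_modulus.
Context {R : realType}.
Implicit Types z w : R[i].

Lemma normcE z : `|z| = (normc z)%:C.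
Proof. by []. Qed.

Lemma normcX z n : normc (z ^+ n) = normc z ^+ n.
Proof.
elim: n => [|n IH]; first by rewrite !expr0 normc1.
by rewrite !exprS normcM IH.
Qed.

Lemma normc_real (x : R) : normc x%:C = `|x|.
Proof. by rewrite /normc /= expr0n addr0 sqrtr_sqr. Qed.

Lemma normc_nat n : normc (n%:R : R[i]) = n%:R.
Proof. by rewrite -(rmorph_nat (real_complex R)) normc_real ger0_norm. Qed.

Lemma normc_gt0 z : (0 < normc z) = (z != 0).
Proof.
rewrite lt_neqAle normc_ge0 andbT eq_sym; congr negb.
by apply/eqP/eqP => [/eq0_normc//|->]; rewrite normc0.
Qed.

Lemma ler_normcB z w : normc (z - w) <= normc z + normc w.
Proof. by rewrite (le_trans (le_normcD _ _))// normcN. Qed.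

Lemma lerB_normc z w : normc z - normc w <= normc (z - w).
Proof. by rewrite lerBlDr -{1}(subrK w z) le_normcD. Qed.

Lemma ler_Re_normc z : `|complex.Re z| <= normc z.
Proof. by case: z => a b /=; rewrite -sqrtr_sqr ler_wsqrtr// lerDl sqr_ge0. Qed.

Lemma ler_Im_normc z : `|complex.Im z| <= normc z.
Proof. by case: z => a b /=; rewrite -sqrtr_sqr ler_wsqrtr// lerDr sqr_ge0. Qed.

Lemma ler_normc_ReIm z : normc z <= `|complex.Re z| + `|complex.Im z|.
Proof.
have : normc (complex.Re z)%:C + normc ('i * (complex.Im z)%:C) =
       `|complex.Re z| + `|complex.Im z|.
  rewrite normcM !normc_real; congr (_ + _).
  by rewrite /normc /= expr0n expr1n add0r sqrtr1 mul1r.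
by move=> <-; rewrite {1}(complexE z) le_normcD.
Qed.

Lemma gt0_complexE z : 0 < z -> exists2 x : R, 0 < x & z = x%:C.
Proof.
move=> z0; have zE : z = (complex.Re z)%:C by rewrite RRe_real// gtr0_real.
by exists (complex.Re z) => //; move: z0; rewrite {1}zE ltcR.
Qed.

End complex_modulus.

(** * Complex derivatives as first-order approximations *)

Section complex_derivative.
Context {R : realType}.
Local Notation C := (R[i]^o).
Implicit Types (f : R[i] -> R[i]) (z w d : R[i]).

(** The derivative in epsilon-delta form, with real bounds and with w = z allowed: this is the form
    that Goursat's lemma integrates and that termwise differentiation produces. *)
Definition affine_approx f z d := forall e : R, 0 < e -> exists2 r : R, 0 < r &
  forall w, normc (w - z) < r -> normc (f w - f z - d * (w - z)) <= e * normc (w - z).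

Lemma derivable_approx f z : derivable (f : C -> C) z 1 -> exists d, affine_approx f z d.
Proof.
move=> df; pose D : R[i] := 'D_1 (f : C -> C) z; exists D => e e0.
have /cvgrPdist_lt/(_ e%:C) : (h : R[i])^-1 *: (((f : C -> C) \o shift z) (h *: 1) - (f z : C))
  @[h --> (0 : C)^'] --> 'D_1 (f : C -> C) z by exact: df.
rewrite ltcR => /(_ e0) /nbhs_ballP[r0 /= r00 H].
have [r r_gt0 r0E] := gt0_complexE r00.
exists r => // w wr.
have [->|wz] := eqVneq w z; first by rewrite !subrr mulr0 subrr normc0 mulr0.
have hn0 : w - z != 0 by rewrite subr_eq0.
have := H (w - z); rewrite /ball /= sub0r normrN normcE r0E ltcR => /(_ wr hn0).
rewrite /= /GRing.scale /= mulr1 subrK normcE ltcR -/D => /ltW.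
have -> : f w - f z - D * (w - z) =
   - (w - z) * (D - (w - z)^-1 * (f w - f z)) by field.
move=> He; rewrite normcM normcN [leRHS]mulrC.
by apply: ler_wpM2l He; exact: normc_ge0.
Qed.

Lemma approx_cvg f z d : affine_approx f z d ->
  (h : R[i])^-1 *: (((f : C -> C) \o shift z) (h *: 1) - (f z : C)) @[h --> (0 : C)^'] --> (d : C).
Proof.
move=> H; apply/cvgrPdist_le => e0 e00.
have [e e_gt0 ->] := gt0_complexE e00.
have [r r0 Hr] := H _ e_gt0.
apply/nbhs_ballP; exists r%:C; first by rewrite /= ltcR.
move=> h /=; rewrite /ball /= sub0r normrN normcE ltcR => hr hn0.
rewrite normcE lecR /GRing.scale /= mulr1.
have := Hr (h + z); rewrite addrK => /(_ hr) Hh.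
have -> : d - h^-1 * (f (h + z) - f z) = - (h^-1 * (f (h + z) - f z - d * h)).
  by rewrite (mulrBr _ _ (d * h)) mulrCA mulVf// mulr1 opprB.
rewrite normcN normcM normcV ler_pdivrMl ?normc_gt0//.
by rewrite [leRHS]mulrC.
Qed.

Lemma derive1_approx f z d : affine_approx f z d -> derive1 (f : C -> C) z = d.
Proof.
by move=> /approx_cvg H; rewrite derive1E; apply: cvg_lim H; exact: norm_hausdorff.
Qed.

Lemma derivable_continuous_at (f : C -> C) z : derivable f z 1 -> {for z, continuous f}.
Proof. by move=> /derivable1_diffP /differentiable_continuous. Qed.

End complex_derivative.

(** * Integrals of complex-valued functions over a real segment *)

Section complex_integral.
Context {R : realType}.
Local Notation C := (R[i]^o).
Local Notation mu := (@lebesgue_measure R).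
Implicit Types (g h : R -> R[i]) (a b t : R).

(** Has the shape of [segment_integral], which is thereby convertible to a [cint] over [0, 1]. *)
Definition cint g a b : R[i] :=
  (\int[mu]_(t in `[a, b]) complex.Re (g t)) +i*
  (\int[mu]_(t in `[a, b]) complex.Im (g t)).

Definition cintegrable g a b :=
  mu.-integrable `[a, b] (EFin \o (fun t => complex.Re (g t))) /\
  mu.-integrable `[a, b] (EFin \o (fun t => complex.Im (g t))).

Lemma eq_cint g h a b : (forall t, a <= t <= b -> g t = h t) ->
  cint g a b = cint h a b.
Proof.
move=> gh; rewrite /cint; congr (_ +i* _); apply: eq_Rintegral => t;
  by rewrite inE/= in_itv/= => /gh ->.
Qed.

Lemma ReD (z w : R[i]) : complex.Re (z + w) = complex.Re z + complex.Re w.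
Proof. by case: z; case: w. Qed.
Lemma ImD (z w : R[i]) : complex.Im (z + w) = complex.Im z + complex.Im w.
Proof. by case: z; case: w. Qed.
Lemma ReM (z w : R[i]) :
  complex.Re (z * w) = complex.Re z * complex.Re w - complex.Im z * complex.Im w.
Proof. by case: z; case: w. Qed.
Lemma ImM (z w : R[i]) :
  complex.Im (z * w) = complex.Re z * complex.Im w + complex.Im z * complex.Re w.
Proof. by case: z; case: w. Qed.

Let ilin (u v : R -> R) (k l a b : R) :
  mu.-integrable `[a, b] (EFin \o u) -> mu.-integrable `[a, b] (EFin \o v) ->
  mu.-integrable `[a, b] (EFin \o (fun t => k * u t + l * v t)).
Proof.
move=> iu iv.
have iku := @integrableZl _ _ _ mu `[a, b] (measurable_itv _) k _ iu.
have ilv := @integrableZl _ _ _ mu `[a, b] (measurable_itv _) l _ iv.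
exact: (@integrableD _ _ _ mu `[a, b] (measurable_itv _) _ _ iku ilv).
Qed.

Let Rlin (u v : R -> R) (k l a b : R) :
  mu.-integrable `[a, b] (EFin \o u) -> mu.-integrable `[a, b] (EFin \o v) ->
  \int[mu]_(t in `[a, b]) (k * u t + l * v t) =
  k * \int[mu]_(t in `[a, b]) u t + l * \int[mu]_(t in `[a, b]) v t.
Proof.
move=> iu iv; rewrite RintegralD//.
- by rewrite !RintegralZl.
- exact: (@integrableZl _ _ _ mu `[a, b] (measurable_itv _) k _ iu).
- exact: (@integrableZl _ _ _ mu `[a, b] (measurable_itv _) l _ iv).
Qed.

Let lin1 (u v : R) : u + v = 1 * u + 1 * v. Proof. by rewrite !mul1r. Qed.

Lemma cintegrableD g h a b : cintegrable g a b -> cintegrable h a b ->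
  cintegrable (fun t => g t + h t) a b.
Proof.
move=> [gr gi] [hr hi]; split.
  under [X in EFin \o X]funext do rewrite ReD lin1.
  exact: ilin.
under [X in EFin \o X]funext do rewrite ImD lin1.
exact: ilin.
Qed.

Lemma cintD g h a b : cintegrable g a b -> cintegrable h a b ->
  cint (fun t => g t + h t) a b = cint g a b + cint h a b.
Proof.
move=> [gr gi] [hr hi]; rewrite /cint.
under eq_Rintegral do rewrite ReD lin1.
under [X in _ +i* X]eq_Rintegral do rewrite ImD lin1.
by rewrite !Rlin// !mul1r.
Qed.

Lemma cintegrableZ g a b k : cintegrable g a b ->
  cintegrable (fun t => k * g t) a b.
Proof.
move=> [gr gi]; split.
  under [X in EFin \o X]funext do rewrite ReM -mulNr.
  exact: ilin.
under [X in EFin \o X]funext do rewrite ImM.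
exact: ilin.
Qed.

Lemma cintZ g a b k : cintegrable g a b ->
  cint (fun t => k * g t) a b = k * cint g a b.
Proof.
move=> [gr gi]; rewrite /cint.
under eq_Rintegral do rewrite ReM -mulNr.
under [X in _ +i* X]eq_Rintegral do rewrite ImM.
by rewrite !Rlin//; case: k => k l /=; rewrite mulNr.
Qed.

Lemma cintegrableB g h a b : cintegrable g a b -> cintegrable h a b ->
  cintegrable (fun t => g t - h t) a b.
Proof.
move=> ig ih; under [X in cintegrable X]funext do rewrite -(mulN1r (h _)).
exact/cintegrableD/cintegrableZ.
Qed.

Lemma cintB g h a b : cintegrable g a b -> cintegrable h a b ->
  cint (fun t => g t - h t) a b = cint g a b - cint h a b.
Proof.
move=> ig ih; under [X in cint X]funext do rewrite -(mulN1r (h _)).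
by rewrite cintD ?cintZ ?mulN1r//; exact: cintegrableZ.
Qed.

Let Rcst (k a b : R) : a <= b -> \int[mu]_(t in `[a, b]) k = k * (b - a).
Proof.
move=> ab; have -> : b - a = fine (mu `[a, b]).
  rewrite lebesgue_measure_itv/= lte_fin.
  by case: ltgtP ab => [||->]//=; rewrite subrr.
exact: Rintegral_cst.
Qed.

Lemma cint_cst k a b : a <= b -> cint (fun=> k) a b = k * (b - a)%:C.
Proof.
move=> ab; rewrite /cint !Rcst//.
by case: k => k l /=; simpc.
Qed.

Lemma cint_split g a m b : a <= m -> m <= b -> cintegrable g a b ->
  cint g a b = cint g a m + cint g m b.
Proof.
move=> am mb [gr gi].
have split1 (u : R -> R) : mu.-integrable `[a, b] (EFin \o u) ->
    \int[mu]_(t in `[a, b]) u t =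
    \int[mu]_(t in `[a, m]) u t + \int[mu]_(t in `[m, b]) u t.
  move=> iu; have := Rintegral_itvB iu (x := m).
  rewrite !bnd_simp => /(_ am mb) H.
  rewrite -(Rintegral_itv_obnd_cbnd (r := m)); last first.
    apply: integrableS iu => //; apply: subset_itv => //; rewrite bnd_simp//.
  by rewrite -H addrC subrK.
by rewrite /cint !split1.
Qed.

Lemma cintegrable_cont g a b :
  (forall t, a <= t <= b -> {for t, continuous (g : R -> C)}) -> cintegrable g a b.
Proof.
move=> cg.
(* [Re] and [Im] are both 1-Lipschitz, so one argument serves the two components. *)
have H (p : C -> R) : (forall z w, `|p z - p w| <= normc (z - w)) ->
    mu.-integrable `[a, b] (EFin \o (fun t => p (g t))).
  move=> pl; apply: continuous_compact_integrable; first exact: segment_compact.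
  apply: continuous_in_subspaceT => t; rewrite inE/= in_itv/= => /cg ct.
  apply/cvgrPdist_lt => e e0.
  have /cvgrPdist_lt/(_ e%:C) := ct; rewrite ltcR => /(_ e0).
  apply: filterS => s; rewrite normcE ltcR; apply: le_lt_trans.
  exact: pl.
split.
  apply: (H (@complex.Re R)) => z w.
  by rewrite (le_trans _ (ler_Re_normc _))//; case: z => ? ?; case: w.
apply: (H (@complex.Im R)) => z w.
by rewrite (le_trans _ (ler_Im_normc _))//; case: z => ? ?; case: w.
Qed.

(** The factor 2 comes from bounding the real and imaginary parts separately; all uses tolerate a
    constant. *)
Lemma cint_bound g a b B : a <= b -> cintegrable g a b ->
  (forall t, a <= t <= b -> normc (g t) <= B) ->
  normc (cint g a b) <= 2 * (B * (b - a)).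
Proof.
move=> ab [gr gi] gB.
have icst : mu.-integrable `[a, b] (EFin \o (fun=> B)).
  by apply: continuous_compact_integrable;
    [exact: segment_compact|apply: continuous_subspaceT => ?; exact: cvg_cst].
have bd (u : R -> R) : mu.-integrable `[a, b] (EFin \o u) ->
    (forall t, a <= t <= b -> `|u t| <= B) ->
    `|\int[mu]_(t in `[a, b]) u t| <= B * (b - a).
  move=> iu uB; apply: (le_trans (le_normr_Rintegral _ iu)) => //; rewrite -Rcst//.
  apply: le_Rintegral => //; exact: (integrable_abse iu).
apply: (le_trans (ler_normc_ReIm _)); rewrite mulr_natl mulr2n.
apply: lerD; apply: bd => // t tab.
  by rewrite (le_trans (ler_Re_normc _))// gB.
by rewrite (le_trans (ler_Im_normc _))// gB.
Qed.

End complex_integral.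

(** * Bisection of rectangles *)

Section rectangle_bisection.
Context {R : realType}.
Implicit Types (a b c d x y : R).

Lemma nested_intervals (a b : nat -> R) :
  (forall n, a n <= a n.+1) -> (forall n, b n.+1 <= b n) ->
  (forall n, a n <= b n) -> exists x, forall n, a n <= x <= b n.
Proof.
move=> a_inc b_dec ab.
have amono : {homo a : m n / (m <= n)%N >-> m <= n}.
  exact: homo_leq (@lexx _ _) (@le_trans _ _) a_inc.
have bmono : {homo b : m n / (m <= n)%N >-> n <= m}.
  by apply: (@homo_leq _ b (fun x y => y <= x)) => // x y z xy yz; exact: le_trans yz xy.
have amb m n : a m <= b n.
  rewrite (le_trans (amono _ _ (leq_maxl m n)))//.
  by rewrite (le_trans (ab _))// bmono// leq_maxr.
exists (sup (range a)) => n; apply/andP; split.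
  by apply: ub_le_sup; [exists (b 0%N) => _ [m _ <-]|exists n].
by apply: ge_sup => [|_ [m _ <-]//]; exists (a 0%N), 0%N.
Qed.

(** The tuple (a, b, c, d) stands for [a, b] x [c, d]. *)
Definition rect : Type := R * R * R * R.

(** Includes the ordering of the endpoints of [q], so that [subrect q q] expresses that [q] is a
    genuine rectangle. *)
Definition subrect (q q' : rect) : Prop :=
  let: (a, b, c, d) := q in let: (a', b', c', d') := q' in
  [/\ a' <= a, a <= b, b <= b' & [/\ c' <= c, c <= d & d <= d']].

Definition halfperim (q : rect) : R :=
  let: (a, b, c, d) := q in (b - a) + (d - c).

Definition in_rect (q : rect) x y : Prop :=
  let: (a, b, c, d) := q in a <= x <= b /\ c <= y <= d.

Lemma subrect_trans q1 q2 q3 : subrect q1 q2 -> subrect q2 q3 -> subrect q1 q3.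
Proof.
case: q1 q2 q3 => [[[a1 b1] c1] d1] [[[a2 b2] c2] d2] [[[a3 b3] c3] d3] /=.
by move=> [? ? ? [? ? ?]] [? ? ? [? ? ?]]; split; [lra..|split; lra].
Qed.

(** Halving in x, then in y, finds a quarter carrying at least 1/4 of the modulus of [Psi], while
    the squared half-perimeter h^2 is also divided by 4. The nested quarters share a point, and the
    local estimate there gives |Psi| <= 4^n e (h / 2^n)^2 = e h^2 for n large, for every e > 0. *)
Lemma additive_rect_eq0 (Psi : rect -> R[i]) a0 b0 c0 d0 :
  a0 <= b0 -> c0 <= d0 ->
  (forall a m b c d, subrect (a, b, c, d) (a0, b0, c0, d0) -> a <= m <= b ->
    Psi (a, b, c, d) = Psi (a, m, c, d) + Psi (m, b, c, d)) ->
  (forall a b c m d, subrect (a, b, c, d) (a0, b0, c0, d0) -> c <= m <= d ->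
    Psi (a, b, c, d) = Psi (a, b, c, m) + Psi (a, b, m, d)) ->
  (forall x y, in_rect (a0, b0, c0, d0) x y -> forall e, 0 < e ->
    exists2 r, 0 < r & forall q, subrect q (a0, b0, c0, d0) -> in_rect q x y ->
      halfperim q < r -> normc (Psi q) <= e * halfperim q ^+ 2) ->
  Psi (a0, b0, c0, d0) = 0.
Proof.
move=> ab0 cd0 addx addy small.
pose q0 : rect := (a0, b0, c0, d0).
have step q : subrect q q0 -> exists q',
    [/\ subrect q' q, halfperim q' = halfperim q / 2 &
        normc (Psi q) <= 4 * normc (Psi q')].
  case: q => [[[a b] c] d] sq; have [h1 h2 h3 [h4 h5 h6]] := sq.
  pose m := (a + b) / 2; pose n := (c + d) / 2.
  have am : a <= m by rewrite /m; lra.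
  have mb : m <= b by rewrite /m; lra.
  have cn : c <= n by rewrite /n; lra.
  have nd : n <= d by rewrite /n; lra.
  have half (u v w : R[i]) : u = v + w ->
      normc u <= 2 * normc v \/ normc u <= 2 * normc w.
    move=> ->; have [vw|/ltW wv] := leP (normc v) (normc w); [right|left];
      by apply: le_trans (le_normcD _ _) _; lra.
  have [a' [b' [e1 e2 e3 [e4 e5]]]] : exists a' b', [/\ a <= a', a' <= b', b' <= b &
      b' - a' = (b - a) / 2 /\
      normc (Psi (a, b, c, d)) <= 2 * normc (Psi (a', b', c, d))].
    have [H|H] := half _ _ _ (addx a m b c d sq (introT andP (conj am mb))).
      by exists a, m; split; rewrite ?lexx//; split=> //; rewrite /m; lra.
    by exists m, b; split; rewrite ?lexx//; split=> //; rewrite /m; lra.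
  have sq' : subrect (a', b', c, d) q0 by rewrite /= ; split; [lra..|split; lra].
  have [c' [d' [f1 f2 f3 [f4 f5]]]] : exists c' d', [/\ c <= c', c' <= d', d' <= d &
      d' - c' = (d - c) / 2 /\
      normc (Psi (a', b', c, d)) <= 2 * normc (Psi (a', b', c', d'))].
    have [H|H] := half _ _ _ (addy a' b' c n d sq' (introT andP (conj cn nd))).
      by exists c, n; split; rewrite ?lexx//; split=> //; rewrite /n; lra.
    by exists n, d; split; rewrite ?lexx//; split=> //; rewrite /n; lra.
  exists (a', b', c', d'); split => /=; first by split=> //.
    by rewrite e4 f4; lra.
  by lra.
have q00 : subrect q0 q0 by rewrite /=; split; [lra..|split; lra].
have /choice[F HF] : forall q, exists q', subrect q q0 ->
    [/\ subrect q' q, halfperim q' = halfperim q / 2 &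
        normc (Psi q) <= 4 * normc (Psi q')].
  move=> q; have [/step[q' H]|H] := pselect (subrect q q0); by [exists q'|exists q].
pose s n := iter n F q0.
have sS n : subrect (s n) q0.
  elim: n => [|n IH]//; have [H _ _] := HF _ IH; exact: subrect_trans H IH.
have hS n : halfperim (s n) = halfperim q0 / 2 ^+ n.
  elim: n => [|n IH]; first by rewrite expr0 divr1.
  by have [_ -> _] := HF _ (sS n); rewrite IH exprS invfM mulrA mulrAC.
have pS n : normc (Psi q0) <= 4 ^+ n * normc (Psi (s n)).
  elim: n => [|n IH]; first by rewrite expr0 mul1r.
  have [_ _ H] := HF _ (sS n); apply: le_trans IH _.
  by rewrite exprSr -mulrA ler_wpM2l// exprn_ge0.
have mono n : [/\ (s n).1.1.1 <= (s n.+1).1.1.1, (s n.+1).1.1.2 <= (s n).1.1.2,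
    (s n).1.1.1 <= (s n).1.1.2 & [/\ (s n).1.2 <= (s n.+1).1.2,
    (s n.+1).2 <= (s n).2 & (s n).1.2 <= (s n).2]].
  have sub : subrect (s n.+1) (s n) by case: (HF _ (sS n)).
  have := sS n; move: sub; rewrite /q0.
  move: (s n) (s n.+1) => [[[a b] c] d] [[[a' b'] c'] d'] /=.
  by move=> [? ? ? [? ? ?]] [? ? ? [? ? ?]].
have [x Hx] : exists x, forall n, (s n).1.1.1 <= x <= (s n).1.1.2.
  by apply: nested_intervals => n; case: (mono n).
have [y Hy] : exists y, forall n, (s n).1.2 <= y <= (s n).2.
  by apply: nested_intervals => n; case: (mono n) => _ _ _ [].
have inxy n : in_rect (s n) x y.
  by have := Hx n; have := Hy n; case: (s n) => [[[a b] c] d].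
have h0 : 0 <= halfperim q0 by rewrite /=; lra.
apply: eq0_normc; apply/eqP; rewrite eq_le normc_ge0 andbT.
suff H e : 0 < e -> normc (Psi q0) <= e * halfperim q0 ^+ 2.
  have h1 : 0 < halfperim q0 ^+ 2 + 1 by rewrite ltr_wpDl// sqr_ge0.
  apply/ler_addgt0Pr => e e0; rewrite add0r.
  apply: le_trans (H (e / (halfperim q0 ^+ 2 + 1)) _) _; first exact: divr_gt0.
  by rewrite mulrAC ler_pdivrMr// ler_wpM2l ?ltW// ltrDl.
move=> e0; have [r r0 Hr] := small x y (inxy 0%N) e e0.
have [n Hn] : exists n, halfperim (s n) < r.
  have := @cvg_geometric R (halfperim q0) 2^-1.
  rewrite ger0_norm ?invr_ge0// invf_lt1// ltr1n => /(_ isT)/cvgrPdist_lt/(_ _ r0).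
  move=> [n _ /(_ n (leqnn n))]; rewrite /= sub0r normrN => H; exists n.
  by rewrite hS -exprVn (le_lt_trans (ler_norm _)).
apply: le_trans (pS n) _.
have := Hr _ (sS n) (inxy n) Hn; rewrite hS => H.
apply: le_trans (ler_wpM2l (exprn_ge0 n (ler0n _ 4)) H) _.
rewrite expr_div_n -exprM mulnC exprM (_ : 2 ^+ 2 = 4); last by rewrite expr2 -natrM.
by rewrite mulrCA [_ / _]mulrC mulVKf// expf_neq0// pnatr_eq0.
Qed.

End rectangle_bisection.

(** * Boundary integrals of rectangles and Goursat's lemma *)

Section rectangle_integral.
Context {R : realType}.
Local Notation C := (R[i]^o).
Implicit Types (f g : R[i] -> R[i]) (a b c d x y : R) (z w : R[i]).

(* the integral of f along the positively oriented boundary of [a, b] x [c, d],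
   opposite sides being paired *)
Definition rectint f (q : rect) : R[i] := let: (a, b, c, d) := q in
  cint (fun x => f (x +i* c) - f (x +i* d)) a b +
  'i * cint (fun y => f (b +i* y) - f (a +i* y)) c d.

Arguments rectint : simpl never.

Definition edge (q : rect) z := let: (a, b, c, d) := q in
  (a <= complex.Re z <= b /\ (complex.Im z = c \/ complex.Im z = d)) \/
  (c <= complex.Im z <= d /\ (complex.Re z = a \/ complex.Re z = b)).

Definition edge_integrable f (q : rect) : Prop := let: (a, b, c, d) := q in
  (forall y, y = c \/ y = d -> cintegrable (fun x => f (x +i* y)) a b) /\
  (forall x, x = a \/ x = b -> cintegrable (fun y => f (x +i* y)) c d).

Lemma continuous_hline y : continuous (fun x => (x +i* y : C)).
Proof.
move=> x; apply/cvgrPdist_lt => e0 e00.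
have [e e_gt0 ->] := gt0_complexE e00.
apply/nbhs_ballP; exists e => // t; rewrite /ball /= => te.
by rewrite normcE ltcR /= subrr expr0n addr0 sqrtr_sqr.
Qed.

Lemma continuous_vline x : continuous (fun y => (x +i* y : C)).
Proof.
move=> y; apply/cvgrPdist_lt => e0 e00.
have [e e_gt0 ->] := gt0_complexE e00.
apply/nbhs_ballP; exists e => // t; rewrite /ball /= => te.
by rewrite normcE ltcR /= subrr expr0n add0r sqrtr_sqr.
Qed.

Lemma cintegrable_hline f a b y :
  (forall x, a <= x <= b -> derivable (f : C -> C) (x +i* y) 1) ->
  cintegrable (fun x => f (x +i* y)) a b.
Proof.
move=> df; apply: cintegrable_cont => x xab.
apply: (@continuous_comp R C C (fun x : R => (x +i* y : C)) (f : C -> C) x).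
  exact: continuous_hline.
exact/derivable_continuous_at/df.
Qed.

Lemma cintegrable_vline f c d x :
  (forall y, c <= y <= d -> derivable (f : C -> C) (x +i* y) 1) ->
  cintegrable (fun y => f (x +i* y)) c d.
Proof.
move=> df; apply: cintegrable_cont => y ycd.
apply: (@continuous_comp R C C (fun y : R => (x +i* y : C)) (f : C -> C) y).
  exact: continuous_vline.
exact/derivable_continuous_at/df.
Qed.

Lemma edge_integrable_derivable f q :
  (forall z, edge q z -> derivable (f : C -> C) z 1) -> edge_integrable f q.
Proof.
case: q => [[[a b] c] d] df; split => [y yE|x xE].
  by apply: cintegrable_hline => x xab; apply: df; left.
by apply: cintegrable_vline => y ycd; apply: df; right.
Qed.

Lemma eq_rectint f g q : (forall z, edge q z -> f z = g z) ->
  subrect q q -> rectint f q = rectint g q.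
Proof.
case: q => [[[a b] c] d] fg [_ ab _ [_ cd _]]; rewrite /rectint.
congr (_ + 'i * _); apply: eq_cint => t tab.
  by rewrite !fg//=; left; split => //; [right|left].
by rewrite !fg//=; right; split => //; [left|right].
Qed.

Lemma edge_integrableD f g q : edge_integrable f q -> edge_integrable g q ->
  edge_integrable (fun z => f z + g z) q.
Proof.
case: q => [[[a b] c] d] [fh fv] [gh gv]; split => u uE; apply: cintegrableD;
  by [exact: fh|exact: gh|exact: fv|exact: gv].
Qed.

Lemma edge_integrableZ f k q : edge_integrable f q ->
  edge_integrable (fun z => k * f z) q.
Proof.
by case: q => [[[a b] c] d] [fh fv]; split => u uE; apply: cintegrableZ;
  [exact: fh|exact: fv].
Qed.

Lemma rectintD f g q : edge_integrable f q -> edge_integrable g q ->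
  rectint (fun z => f z + g z) q = rectint f q + rectint g q.
Proof.
case: q => [[[a b] c] d] [fh fv] [gh gv]; rewrite /rectint !cintB ?cintD;
  try (by [apply: fh; [left|right]|apply: fv; [left|right]|apply: gh; [left|right]
     |apply: gv; [left|right]|apply: fh; left|apply: fh; right|apply: fv; left
     |apply: fv; right|apply: gh; left|apply: gh; right|apply: gv; left
     |apply: gv; right]).
- by ring.
- by apply: cintegrableD; [apply: fv|apply: gv]; right.
- by apply: cintegrableD; [apply: fv|apply: gv]; left.
- by apply: cintegrableD; [apply: fh|apply: gh]; left.
- by apply: cintegrableD; [apply: fh|apply: gh]; right.
Qed.

Lemma rectintZ f k q : edge_integrable f q ->
  rectint (fun z => k * f z) q = k * rectint f q.
Proof.
case: q => [[[a b] c] d] [fh fv]; rewrite /rectint.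
under [X in X + _]eq_cint do rewrite -mulrBr.
under [X in _ + 'i * X]eq_cint do rewrite -mulrBr.
rewrite !cintZ; [by ring| |]; apply: cintegrableB;
  by [apply: fh; left|apply: fh; right|apply: fv; left|apply: fv; right].
Qed.

(** The boundary has length 2 [halfperim q], and [cint_bound] loses another factor 2. *)
Lemma rectint_bound f q B : edge_integrable f q -> subrect q q ->
  (forall z, edge q z -> normc (f z) <= B) ->
  normc (rectint f q) <= 4 * (B * halfperim q).
Proof.
case: q => [[[a b] c] d] [fh fv] [_ ab _ [_ cd _]] fB; rewrite /rectint.
have B2 z w : edge (a, b, c, d) z -> edge (a, b, c, d) w ->
    normc (f z - f w) <= 2 * B.
  move=> /fB zB /fB wB; apply: (le_trans (ler_normcB _ _)); lra.
have -> : 4 * (B * halfperim (a, b, c, d)) =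
    2 * ((2 * B) * (b - a)) + 2 * ((2 * B) * (d - c)) by rewrite /=; ring.
apply: (le_trans (le_normcD _ _)); apply: lerD.
  apply: cint_bound => // [|t tab].
    by apply: cintegrableB; apply: fh; [left|right].
  by apply: B2; left; split => //; [left|right].
rewrite normcM (_ : normc 'i = 1) ?mul1r; last first.
  by rewrite /normc /= expr0n expr1n add0r sqrtr1.
apply: cint_bound => // [|t tcd].
  by apply: cintegrableB; apply: fv; [right|left].
by apply: B2; right; split => //; [right|left].
Qed.

Lemma rectint_addx f a m b c d : a <= m <= b ->
  edge_integrable f (a, b, c, d) -> cintegrable (fun y => f (m +i* y)) c d ->
  rectint f (a, b, c, d) = rectint f (a, m, c, d) + rectint f (m, b, c, d).
Proof.
move=> /andP[am mb] [fh fv] fm; rewrite /rectint (cint_split am mb); last first.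
  by apply: cintegrableB; apply: fh; [left|right].
have fa := fv a (or_introl erefl); have fb := fv b (or_intror erefl).
by rewrite !(cintB (a := c))//; ring.
Qed.

Lemma rectint_addy f a b c m d : c <= m <= d ->
  edge_integrable f (a, b, c, d) -> cintegrable (fun x => f (x +i* m)) a b ->
  rectint f (a, b, c, d) = rectint f (a, b, c, m) + rectint f (a, b, m, d).
Proof.
move=> /andP[cm md] [fh fv] fm; rewrite /rectint (cint_split cm md); last first.
  by apply: cintegrableB; apply: fv; [right|left].
have fc := fh c (or_introl erefl); have fd := fh d (or_intror erefl).
by rewrite !(cintB (a := a))//; ring.
Qed.

(** With opposite sides paired, both integrands are constant, equal to l i (c - d) and l (b - a).
    Multiplied by the side lengths, and by i for the vertical pair, they cancel. *)
Lemma rectint_affine k l q : subrect q q ->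
  rectint (fun z => k + l * z) q = 0.
Proof.
case: q => [[[a b] c] d] [_ ab _ [_ cd _]]; rewrite /rectint.
rewrite (@eq_cint _ _ (fun=> l * ('i * (c - d)%:C))); last first.
  move=> x _; rewrite opprD addrACA subrr add0r -mulrBr; congr (l * _).
  by apply/eqP; rewrite eq_complex /=; apply/andP; split; apply/eqP; ring.
rewrite (@eq_cint _ (fun y => _ - _) (fun=> l * (b - a)%:C)); last first.
  move=> x _; rewrite opprD addrACA subrr add0r -mulrBr; congr (l * _).
  by apply/eqP; rewrite eq_complex /=; apply/andP; split; apply/eqP; ring.
by rewrite !cint_cst// !rmorphB; ring.
Qed.

Lemma edge_in_rect q z : subrect q q -> edge q z ->
  in_rect q (complex.Re z) (complex.Im z).
Proof.
by case: q => [[[a b] c] d] [_ ab _ [_ cd _]] /= [[? [->|->]]|[? [->|->]]];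
  rewrite ?lexx ?ab ?cd.
Qed.

(** [rectint f] is additive under both kinds of cuts. Near any point f is affine up to an error of
    order e |z - z0|: the affine part integrates to 0, and the error contributes O(e h^2) on a
    rectangle of half-perimeter h. *)
Lemma goursat f q : subrect q q ->
  (forall x y, in_rect q x y -> derivable (f : C -> C) (x +i* y) 1) ->
  rectint f q = 0.
Proof.
move=> qq df; case: q qq df => [[[a b] c] d] qq df.
have [_ ab _ [_ cd _]] := qq.
have sub_in q' x y : subrect q' (a, b, c, d) -> in_rect q' x y ->
    in_rect (a, b, c, d) x y.
  case: q' => [[[a' b'] c'] d'] /= [? ? ? [? ? ?]] [/andP[? ?] /andP[? ?]].
  by split; apply/andP; split; lra.
have sub_self q' : subrect q' (a, b, c, d) -> subrect q' q'.
  by case: q' => [[[a' b'] c'] d'] /= [? ? ? [? ? ?]]; split; rewrite ?lexx.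
have edgei q' : subrect q' (a, b, c, d) -> edge_integrable f q'.
  move=> sq; apply: edge_integrable_derivable => -[x y] /(edge_in_rect (sub_self _ sq)).
  by move=> /(sub_in _ _ _ sq); exact: df.
apply: additive_rect_eq0 => //.
- move=> a' m b' c' d' sq amb; apply: rectint_addx => //; first exact: edgei.
  apply: cintegrable_vline => y ycd; apply: df; apply: sub_in sq _; split => //.
- move=> a' b' c' m d' sq amb; apply: rectint_addy => //; first exact: edgei.
  apply: cintegrable_hline => x xab; apply: df; apply: sub_in sq _; split => //.
move=> x y xyin e e0; have [D aD] := derivable_approx (df _ _ xyin).
(* The 4 is the constant of [rectint_bound]. *)
have [r r0 Hr] := aD (e / 4) (divr_gt0 e0 (ltr0n _ 4)).
exists r => // q sq xyq hq.
pose E z : R[i] := f z - f (x +i* y) - D * (z - (x +i* y)).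
pose A z : R[i] := (f (x +i* y) - D * (x +i* y)) + D * z.
have fE z : f z = A z + E z by rewrite /A /E; ring.
have iA : edge_integrable A q.
  apply: edge_integrable_derivable => z _.
  by apply: derivableD; [exact: derivable_cst|
    apply: (derivableM (f := cst D)); [exact: derivable_cst|exact: derivable_id]].
have iE : edge_integrable E q.
  have -> : E = fun z => f z + (-1) * A z by apply/funext => z; rewrite /A /E; ring.
  by apply: edge_integrableD; [exact: edgei|exact: edge_integrableZ].
rewrite (_ : f = fun z => A z + E z); last exact/funext.
rewrite rectintD// rectint_affine ?add0r; last exact: sub_self sq.
have -> : e * halfperim q ^+ 2 = 4 * ((e / 4 * halfperim q) * halfperim q) by field.
apply: rectint_bound => //; first exact: sub_self sq.
move=> z /(edge_in_rect (sub_self _ sq)) zq.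
have dz : normc (z - (x +i* y)) <= halfperim q.
  apply: (le_trans (ler_normc_ReIm _)); move: zq xyq; case: z => u v.
  case: (q) => [[[a' b'] c'] d'] /= [/andP[? ?] /andP[? ?]] [/andP[? ?] /andP[? ?]].
  by apply: lerD; rewrite ler_norml; apply/andP; split; lra.
apply: le_trans (Hr z (le_lt_trans dz hq)) _.
by rewrite ler_wpM2l// divr_ge0// ltW.
Qed.

(** Cuts along the four sides of the small square remove four rectangles that avoid x + i y;
    [goursat] applies to each of them. *)
Lemma rectint_shrink f a b c d x y e :
  a <= x - e -> x + e <= b -> c <= y - e -> y + e <= d -> 0 < e ->
  (forall z, z != x +i* y -> derivable (f : C -> C) z 1) ->
  rectint f (a, b, c, d) = rectint f (x - e, x + e, y - e, y + e).
Proof.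
move=> ax xb cy yd e0 df.
have dfx u v : u != x -> derivable (f : C -> C) (u +i* v) 1.
  by move=> ux; apply: df; apply: contra ux => /eqP[->].
have dfy u v : v != y -> derivable (f : C -> C) (u +i* v) 1.
  by move=> vy; apply: df; apply: contra vy => /eqP[_ ->].
have vl (u v w : R) : u != x -> cintegrable (fun t => f (u +i* t)) v w.
  by move=> ux; apply: cintegrable_vline => t _; exact: dfx.
have hl (u v w : R) : u != y -> cintegrable (fun t => f (t +i* u)) v w.
  by move=> uy; apply: cintegrable_hline => t _; exact: dfy.
have ei a' b' c' d' : a' < x -> x < b' -> c' < y -> y < d' ->
    edge_integrable f (a', b', c', d').
  by move=> ? ? ? ?; split => t [->|->]; (apply: hl || apply: vl); apply/eqP => ?; lra.
rewrite (@rectint_addx _ a (x - e)); [|lra|apply: ei; lra|apply: vl; apply/eqP => ?; lra].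
rewrite (@goursat _ (a, x - e, c, d)); first last.
- by move=> u v /= [/andP[? ?] _]; apply: dfx; apply/eqP => ?; lra.
- by split; [lra..|split; lra].
rewrite add0r (@rectint_addx _ (x - e) (x + e));
  [|lra|apply: ei; lra|apply: vl; apply/eqP => ?; lra].
rewrite (@goursat _ (x + e, b, c, d)); first last.
- by move=> u v /= [/andP[? ?] _]; apply: dfx; apply/eqP => ?; lra.
- by split; [lra..|split; lra].
rewrite addr0 (@rectint_addy _ _ _ c (y - e));
  [|lra|apply: ei; lra|apply: hl; apply/eqP => ?; lra].
rewrite (@goursat _ (x - e, x + e, c, y - e)); first last.
- by move=> u v /= [_ /andP[? ?]]; apply: dfy; apply/eqP => ?; lra.
- by split; [lra..|split; lra].
rewrite add0r (@rectint_addy _ _ _ (y - e) (y + e));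
  [|lra|apply: ei; lra|apply: hl; apply/eqP => ?; lra].
rewrite (@goursat _ (x - e, x + e, y + e, d)); first last.
- by move=> u v /= [_ /andP[? ?]]; apply: dfy; apply/eqP => ?; lra.
- by split; [lra..|split; lra].
by rewrite addr0.
Qed.

End rectangle_integral.

(** * Cauchy's formula and Taylor estimates on squares *)

Section cauchy_formula.
Context {R : realType}.
Local Notation C := (R[i]^o).
Implicit Types (f g : R[i] -> R[i]) (r e : R) (z w : R[i]).

Lemma eq_ler (x y : R) : x = y -> x <= y.
Proof. by move=> ->. Qed.

Definition square r : rect := (- r, r, - r, r).

Lemma square_self r : 0 < r -> subrect (square r) (square r).
Proof. by move=> r0; rewrite /square /=; split; [lra..|split; lra]. Qed.

Lemma edge_square_ge r z : 0 < r -> edge (square r) z -> r <= normc z.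
Proof.
move=> r0 [[_ [E|E]]|[_ [E|E]]].
- by apply: le_trans (ler_Im_normc z); rewrite E normrN ger0_norm// ltW.
- by apply: le_trans (ler_Im_normc z); rewrite E ger0_norm// ltW.
- by apply: le_trans (ler_Re_normc z); rewrite E normrN ger0_norm// ltW.
- by apply: le_trans (ler_Re_normc z); rewrite E ger0_norm// ltW.
Qed.

(** The bound |Re z| + |Im z| gives 2 r instead of the sharp sqrt(2) r. This 2 reappears in the
    ratio exp(2 A) of [exp_type_egf]. *)
Lemma edge_square_le r z : 0 < r -> edge (square r) z -> normc z <= 2 * r.
Proof.
move=> r0 /(edge_in_rect (square_self r0)) [/andP[? ?] /andP[? ?]].
apply: (le_trans (ler_normc_ReIm z)); rewrite mulr_natl mulr2n.
by apply: lerD; rewrite ler_norml; apply/andP; split.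
Qed.

Lemma derivable_mul f g z : derivable (f : C -> C) z 1 ->
  derivable (g : C -> C) z 1 -> derivable ((fun u => f u * g u) : C -> C) z 1.
Proof.
move=> df dg.
have H := @derivableM R[i] C f g z 1 df dg.
exact: H.
Qed.

Lemma derivable_quot f z w k : derivable (f : C -> C) z 1 -> z != w ->
  derivable ((fun u => f u / (u - w) ^+ k) : C -> C) z 1.
Proof.
move=> df zw.
have d1 : derivable ((fun u => u - w) : C -> C) z 1.
  by apply: derivableB; [exact: derivable_id|exact: derivable_cst].
have dk : derivable ((fun u => (u - w) ^+ k) : C -> C) z 1.
  elim: k => [|k IH]; first exact: derivable_cst.
  rewrite (_ : (fun _ => _) = (fun u => (u - w) * (u - w) ^+ k)); last first.
    by apply/funext => u; rewrite exprS.
  exact: (@derivable_mul _ _ _ d1 IH).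
have dv : derivable ((fun u => ((u - w) ^+ k)^-1) : C -> C) z 1.
  apply: (@derivableV R[i] C (fun u => (u - w) ^+ k) z 1 _ dk).
  by rewrite expf_neq0// subr_eq0.
exact: (@derivable_mul _ _ _ df dv).
Qed.

Lemma derivable_quot1 f z w : derivable (f : C -> C) z 1 -> z != w ->
  derivable ((fun u => f u / (u - w)) : C -> C) z 1.
Proof. exact: (@derivable_quot f z w 1). Qed.

Lemma derivable_quot0 f z k : derivable (f : C -> C) z 1 -> z != 0 ->
  derivable ((fun u => f u / u ^+ k) : C -> C) z 1.
Proof.
move=> df z0; rewrite (_ : (fun _ => _) = (fun u => f u / (u - 0) ^+ k)).
  exact: derivable_quot.
by apply/funext => u; rewrite subr0.
Qed.

(** For entire f this is [kappa] times the Taylor coefficient f^(n)(0) / n!. The half-side 1 is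
    arbitrary, by [cauchy_coefE]. *)
Definition cauchy_coef f n := rectint (fun z => f z / z ^+ n.+1) (square 1).

Lemma cauchy_coefE f n r : entire f -> 0 < r ->
  rectint (fun z => f z / z ^+ n.+1) (square r) = cauchy_coef f n.
Proof.
move=> hf r0; pose e : R := Num.min r 1.
have e0 : 0 < e by rewrite lt_min r0 ltr01.
have er : e <= r by rewrite ge_min lexx.
have e1 : e <= 1 by rewrite ge_min lexx orbT.
have dz z : z != 0 +i* 0 -> derivable ((fun z => f z / z ^+ n.+1) : C -> C) z 1.
  exact: derivable_quot0.
rewrite /cauchy_coef /square !(rectint_shrink (x := 0) (y := 0) (e := e))//; lra.
Qed.

Lemma square_integrable f w k r : entire f -> normc w < r ->
  edge_integrable (fun z => f z / (z - w) ^+ k) (square r).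
Proof.
move=> hf wr; have r0 : 0 < r := le_lt_trans (normc_ge0 w) wr.
apply: edge_integrable_derivable => z /(edge_square_ge r0) zr.
by apply: derivable_quot => //; apply: contraTneq wr => <-; rewrite -leNgt.
Qed.

Lemma square_integrable1 f w r : entire f -> normc w < r ->
  edge_integrable (fun z => f z / (z - w)) (square r).
Proof. exact: (@square_integrable f w 1). Qed.

Lemma square_integrable0 f k r : entire f -> 0 < r ->
  edge_integrable (fun z => f z / z ^+ k) (square r).
Proof.
move=> hf r0; rewrite (_ : (fun _ => _) = (fun z => f z / (z - 0) ^+ k)).
  by apply: square_integrable; rewrite ?normc0.
by apply/funext => u; rewrite subr0.
Qed.

(** Cauchy's inequality. The constant 16 is the 4 of [rectint_bound] times the 4 in
    [halfperim (square r)] = 4 r. *)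
Lemma cauchy_coef_le f n r B : entire f -> 0 < r ->
  (forall z, edge (square r) z -> normc (f z) <= B) ->
  normc (cauchy_coef f n) <= 16 * B / r ^+ n.
Proof.
move=> hf r0 fB; rewrite -(cauchy_coefE _ hf r0).
have -> : 16 * B / r ^+ n = 4 * (B / r ^+ n.+1 * halfperim (square r)).
  by rewrite /= exprS; field; rewrite expf_neq0 gt_eqF.
apply: rectint_bound; last 2 first.
- exact: square_self.
- move=> z ze; rewrite normcM normcV normcX; apply: ler_pM.
  + exact: normc_ge0.
  + by rewrite invr_ge0 exprn_ge0// normc_ge0.
  + exact: fB.
  + have zr := edge_square_ge r0 ze.
    rewrite lef_pV2 ?posrE ?exprn_gt0//; last exact: lt_le_trans zr.
    by rewrite lerXn2r// ?nnegrE ?normc_ge0// ltW.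
exact: square_integrable0.
Qed.

(** The exponent starts at 1 for the sake of [cauchy_kernel], where the truncated sum has to contain
    its term of index 0. *)
Lemma geo_small (x K q : R) : 0 <= q -> q < 1 ->
  (forall N, x <= K * q ^+ N.+1) -> x <= 0.
Proof.
move=> q0 q1 H; rewrite leNgt; apply/negP => x0.
have := @cvg_geometric R K q; rewrite ger0_norm// => /(_ q1)/cvgrPdist_lt/(_ _ x0).
move=> [n _ /(_ n.+1 (leqnSn n))]; rewrite /= sub0r normrN => H2.
by have := le_lt_trans (le_trans (H n) (ler_norm _)) H2; rewrite ltxx.
Qed.

(** Iterating 1/(z - w) = 1/z + w / (z (z - w)) gives the geometric expansion of the kernel with the
    exact remainder w^N f(z) / (z^N (z - w)), which is then bounded on the boundary, where |z| >= r
    and |z - w| >= r - |w|. *)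
Lemma cauchy_expand f w r B N : entire f -> normc w < r ->
  (forall z, edge (square r) z -> normc (f z) <= B) ->
  normc (rectint (fun z => f z / (z - w)) (square r) -
         \sum_(n < N) w ^+ n * cauchy_coef f n) <=
  16 * B * r / (r - normc w) * (normc w / r) ^+ N.
Proof.
move=> hf wr fB; have r0 : 0 < r := le_lt_trans (normc_ge0 w) wr.
have rw0 : 0 < r - normc w by rewrite subr_gt0.
have sq_neq z : edge (square r) z -> z != 0 /\ z != w.
  move=> /(edge_square_ge r0) zr; split; apply: contraTneq zr => ->.
    by rewrite normc0 -ltNge.
  by rewrite -ltNge.
have B0 : 0 <= B.
  apply: le_trans (normc_ge0 _) (fB (r +i* r) _); left; split; last by right.
  by rewrite /= lexx andbT ge0_cp// ltW.
pose g k z := f z / z ^+ k / (z - w).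
have gi k : edge_integrable (g k) (square r).
  apply: edge_integrable_derivable => z /sq_neq[z0 zw].
  by apply: (@derivable_quot1 (fun z => f z / z ^+ k)) => //; exact: derivable_quot0.
have ci k : edge_integrable (fun z => f z / z ^+ k) (square r).
  exact: square_integrable0.
have gE k : rectint (g k) (square r) =
    rectint (fun z => f z / z ^+ k.+1) (square r) + w * rectint (g k.+1) (square r).
  rewrite -rectintZ// -rectintD//; last exact: edge_integrableZ.
  apply: eq_rectint; last exact: square_self.
  move=> z /sq_neq[z0 zw]; rewrite /g !exprS; field.
  by rewrite subr_eq0 zw expf_neq0.
have -> : rectint (fun z => f z / (z - w)) (square r) =
    \sum_(n < N) w ^+ n * cauchy_coef f n + w ^+ N * rectint (g N) (square r).
  elim: N => [|N ->].
    rewrite big_ord0 add0r expr0 mul1r; congr rectint; apply/funext => z.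
    by rewrite /g expr0 divr1.
  rewrite gE (cauchy_coefE _ hf r0) (big_ord_recr N).
  by move: (rectint (g N.+1) _) => I /=; rewrite exprSr; ring.
rewrite addrC addKr normcM normcX.
have -> : 16 * B * r / (r - normc w) * (normc w / r) ^+ N =
    normc w ^+ N * (4 * (B / r ^+ N / (r - normc w) * halfperim (square r))).
  rewrite /= expr_div_n; field.
  by rewrite expf_neq0 ?(gt_eqF r0)// (gt_eqF rw0).
apply: ler_wpM2l; first by rewrite exprn_ge0// normc_ge0.
apply: rectint_bound => //; first exact: square_self.
move=> z ze; have zr := edge_square_ge r0 ze.
have zw : r - normc w <= normc (z - w).
  by apply: le_trans (lerB_normc _ _); rewrite lerD2r.
rewrite /g !normcM !normcV normcX; apply: ler_pM.
- by rewrite mulr_ge0 ?invr_ge0 ?exprn_ge0 ?normc_ge0.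
- by rewrite invr_ge0 normc_ge0.
- apply: ler_pM; rewrite ?invr_ge0 ?exprn_ge0 ?normc_ge0//; first exact: fB.
  rewrite lef_pV2 ?posrE ?exprn_gt0//; last exact: lt_le_trans zr.
  by rewrite lerXn2r// ?nnegrE ?normc_ge0// ltW.
- by rewrite lef_pV2 ?posrE//; exact: lt_le_trans zw.
Qed.

(* kappa = 2 i pi, but only kappa != 0 is needed *)
Definition kappa : R[i] := cauchy_coef (fun=> 1) 0.

Lemma entire1 : entire (fun=> 1 : C).
Proof. by move=> z; exact: derivable_cst. Qed.

(** The value is the same on all squares, and Cauchy's inequality for the constant 1 makes it tend
    to 0 along the half-sides 2^(N+1). *)
Lemma cauchy_coef1 n : cauchy_coef (fun=> 1) n.+1 = 0.
Proof.
apply: eq0_normc; apply/eqP; rewrite eq_le normc_ge0 andbT.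
apply: (@geo_small _ 16 (2^-1)) => [||N]; rewrite ?invr_ge0// ?invf_lt1 ?ltr1n//.
have r0 : 0 < 2 ^+ N.+1 :> R by rewrite exprn_gt0.
have := @cauchy_coef_le (fun=> 1) n.+1 _ 1 entire1 r0.
move=> /(_ (fun _ _ => eq_ler (@normc1 R))) H.
apply: (le_trans H); rewrite mulr1 ler_wpM2l// exprVn lef_pV2 ?posrE ?exprn_gt0//.
by rewrite -[leLHS]expr1 ler_weXn2l// exprn_ege1// ler1n.
Qed.

(** In the expansion of 1/(z - w) for the constant function 1, only the coefficient of index 0
    survives, and it is [kappa]. *)
Lemma cauchy_kernel w r : normc w < r ->
  rectint (fun z => (z - w)^-1) (square r) = kappa.
Proof.
move=> wr; have r0 : 0 < r := le_lt_trans (normc_ge0 w) wr.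
have -> : (fun z => (z - w)^-1) = (fun z => (fun=> 1) z / (z - w)).
  by apply/funext => z; rewrite mul1r.
apply/eqP; rewrite -subr_eq0; apply/eqP/eq0_normc/eqP.
rewrite eq_le normc_ge0 andbT.
apply: (@geo_small _ (16 * 1 * r / (r - normc w)) (normc w / r)).
- by rewrite divr_ge0 ?normc_ge0// ltW.
- by rewrite ltr_pdivrMr// mul1r.
move=> N; have := @cauchy_expand (fun=> 1) w r 1 N.+1 entire1 wr.
rewrite big_ord_recl /= expr0 mul1r big1 ?addr0; last first.
  by move=> i _; rewrite cauchy_coef1 mulr0.
by apply=> z _; exact/eq_ler/normc1.
Qed.

(** The difference quotient is bounded by 1 + |D| near w, where D is the derivative. Shrinking the
    square to half-side d around w leaves an integral of modulus at most 16 d (1 + |D|). *)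
Lemma cauchy_diff f w r : entire f -> normc w < r ->
  rectint (fun z => (f z - f w) / (z - w)) (square r) = 0.
Proof.
move=> hf wr; have [D aD] := derivable_approx (hf w).
have [r1 r10 Hr1] := aD 1 ltr01.
case: w wr aD Hr1 => x y wr aD Hr1; set w := x +i* y in wr aD Hr1 *.
have dw z : z != w -> derivable ((fun z => (f z - f w) / (z - w)) : C -> C) z 1.
  move=> zw; apply: (@derivable_quot1 (fun z => f z - f w)) => //.
  by apply: derivableB; [exact: hf|exact: derivable_cst].
apply: eq0_normc; apply/eqP; rewrite eq_le normc_ge0 andbT.
have M0 : 0 < 1 + normc D by rewrite ltr_wpDr// normc_ge0.
apply/ler_addgt0Pr => e e0; rewrite add0r.
(* Points of the small square are within 2 d of w, hence within r1 when d <= r1 / 3; d <= r - |w|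
   keeps it inside [square r]; the last term makes 16 d (1 + |D|) at most e. *)
pose d : R := Num.min (r1 / 3) (Num.min (r - normc w) (e / (16 * (1 + normc D)))).
have d0 : 0 < d by rewrite !lt_min divr_gt0// subr_gt0 wr/= divr_gt0// mulr_gt0.
have dr1 : d <= r1 / 3 by rewrite ge_min lexx.
have dr : d <= r - normc w by rewrite !ge_min lexx !orbT.
have de : d <= e / (16 * (1 + normc D)) by rewrite !ge_min lexx !orbT.
have := ler_Im_normc w; rewrite ler_norml (_ : complex.Im w = y)// => /andP[? ?].
have := ler_Re_normc w; rewrite ler_norml (_ : complex.Re w = x)// => /andP[? ?].
rewrite /square (rectint_shrink (x := x) (y := y) (e := d))//; [|lra..].
have qq : subrect (x - d, x + d, y - d, y + d) (x - d, x + d, y - d, y + d).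
  by split; [lra..|split; lra].
have ew z : edge (x - d, x + d, y - d, y + d) z -> z != w.
  by move=> ze; apply/eqP => zw; move: ze; rewrite zw /= => -[[_ []]|[_ []]] ?; lra.
have H : normc (rectint (fun z => (f z - f w) / (z - w)) (x - d, x + d, y - d, y + d))
    <= 4 * ((1 + normc D) * halfperim (x - d, x + d, y - d, y + d)).
  apply: rectint_bound => //.
    by apply: edge_integrable_derivable => z /ew; exact: dw.
  move=> z ze; have zw := ew z ze; have zw0 : 0 < normc (z - w).
    by rewrite normc_gt0 subr_eq0.
  have zr : normc (z - w) < r1.
    have [] := edge_in_rect qq ze; move=> /andP[? ?] /andP[? ?].
    apply: (le_lt_trans (ler_normc_ReIm _)).
    have -> : complex.Re (z - w) = complex.Re z - x by case: (z).
    have -> : complex.Im (z - w) = complex.Im z - y by case: (z).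
    apply: (@le_lt_trans _ _ (d + d)); last lra.
    by apply: lerD; rewrite ler_norml; apply/andP; split; lra.
  rewrite normcM normcV ler_pdivrMr// mulrDl -normcM.
  rewrite -[X in normc X](subrK (D * (z - w))).
  by apply: (le_trans (le_normcD _ _)); rewrite lerD2r; exact: Hr1.
apply: (le_trans H).
have -> : 4 * ((1 + normc D) * halfperim (x - d, x + d, y - d, y + d)) =
   d * (16 * (1 + normc D)) by rewrite /=; ring.
by rewrite -ler_pdivlMr// mulr_gt0.
Qed.

Lemma cauchy_formula f w r : entire f -> normc w < r ->
  rectint (fun z => f z / (z - w)) (square r) = f w * kappa.
Proof.
move=> hf wr; rewrite -(cauchy_kernel wr).
have ki : edge_integrable (fun z => (z - w)^-1) (square r).
  rewrite (_ : (fun _ => _) = (fun z => 1 / (z - w))).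
    exact: (square_integrable1 entire1).
  by apply/funext => z; rewrite mul1r.
have di : edge_integrable (fun z => (f z - f w) / (z - w)) (square r).
  apply: (@square_integrable1 (fun z => f z - f w) w r _ wr) => z.
  by apply: derivableB; [exact: hf|exact: derivable_cst].
rewrite -rectintZ// -[RHS]add0r -(cauchy_diff hf wr) -rectintD//.
  by congr rectint; apply/funext => z; rewrite -mulrDl subrK.
exact: edge_integrableZ.
Qed.

Lemma Im_cint_ge (g : R -> R[i]) a b k : a <= b -> cintegrable g a b ->
  (forall t, a <= t <= b -> k <= complex.Im (g t)) ->
  k * (b - a) <= complex.Im (cint g a b).
Proof.
move=> ab [_ gi] gk.
have -> : k * (b - a) = \int[lebesgue_measure]_(t in `[a, b]) k.
  have -> : b - a = fine (lebesgue_measure `[a, b]%classic).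
    rewrite lebesgue_measure_itv/= lte_fin.
    by case: ltgtP ab => [||->]//=; rewrite subrr.
  by apply/esym; exact: Rintegral_cst.
apply: le_Rintegral => //; apply: continuous_compact_integrable.
  exact: segment_compact.
by apply: continuous_subspaceT => ?; exact: cvg_cst.
Qed.

(** On the square of half-side 1, each pair of opposite sides contributes the integral over [-1, 1]
    of 2 / (t^2 + 1) to the imaginary part. The integrand is at least 1 there, so each pair gives at
    least 2. *)
Lemma kappa_neq0 : kappa != 0.
Proof.
suff : 4 <= complex.Im kappa.
  by apply: contraTneq => ->; rewrite /= -ltNge.
have [hi vi] : edge_integrable (fun z => 1 / z ^+ 1) (square 1).
  exact: (square_integrable0 1 entire1 ltr01).
rewrite /kappa /cauchy_coef /rectint /square -cintZ; last first.
  by apply: cintegrableB; apply: vi; [right|left].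
rewrite ImD (_ : 4 = 1 * (1 - -1) + 1 * (1 - -1)); last by ring.
have pos (t : R) : -1 <= t <= 1 -> 1 <= 2 / (t ^+ 2 + 1).
  move=> /andP[? ?]; have t0 : 0 < t ^+ 2 + 1 by rewrite ltr_wpDl// sqr_ge0.
  by rewrite ler_pdivlMr// mul1r; nra.
have sq0 (t : R) : t ^+ 2 + 1 != 0 by rewrite gt_eqF// ltr_wpDl// sqr_ge0.
have le11 : -1 <= 1 :> R by lra.
apply: lerD.
  apply: Im_cint_ge => //.
    by apply: cintegrableB; apply: hi; [left|right].
  move=> t tab; apply: (le_trans (pos t tab)).
  by rewrite !expr1 !div1r /= sqrrN expr1n; apply/eq_ler; field; exact: sq0.
apply: Im_cint_ge => //.
  by apply: cintegrableZ; apply: cintegrableB; apply: vi; [right|left].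
move=> t tab; apply: (le_trans (pos t tab)).
rewrite !expr1 !div1r /= sqrrN expr1n [1 + _]addrC; apply/eq_ler.
by field; exact: sq0.
Qed.

Lemma taylor_estimate f w r B N : entire f -> normc w < r ->
  (forall z, edge (square r) z -> normc (f z) <= B) ->
  normc (f w - \sum_(n < N) cauchy_coef f n / kappa * w ^+ n) <=
  16 * B * r / (r - normc w) / normc kappa * (normc w / r) ^+ N.
Proof.
move=> hf wr fB; have := cauchy_expand N hf wr fB.
rewrite cauchy_formula//.
have k0 := kappa_neq0; have nk0 : 0 < normc kappa by rewrite normc_gt0.
have -> : f w * kappa - \sum_(n < N) w ^+ n * cauchy_coef f n =
   kappa * (f w - \sum_(n < N) cauchy_coef f n / kappa * w ^+ n).
  rewrite mulrBr mulr_sumr [f w * _]mulrC; congr (_ - _); apply: eq_bigr => n _.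
  by field.
by rewrite normcM mulrC -ler_pdivlMr// [X in _ <= X -> _]mulrAC.
Qed.

End cauchy_formula.

(** * Exponential generating functions and termwise differentiation *)

Section exponential_generating_functions.
Context {R : realType}.
Local Notation C := (R[i]^o).
Implicit Types (f g : R[i] -> R[i]) (a : nat -> R[i]) (A D : R) (z w h : R[i]).

(** Remainder of the exponential series: under [coef_bounded a A D], A times its value at D |z|
    dominates the remainder of the series of a at z. *)
Definition etail N (x : R) := expR x - series (exp_coeff x) N.

Lemma series_expS (x : R) N :
  series (exp_coeff x) N.+1 = series (exp_coeff x) N + x ^+ N / N`!%:R.
Proof. by rewrite /series /= big_nat_recr. Qed.

Lemma series_exp_le (x : R) N : 0 <= x -> series (exp_coeff x) N <= expR x.
Proof.
move=> x0; apply: nondecreasing_cvgn_le; last exact: is_cvg_series_exp_coeff.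
apply/nondecreasing_seqP => n; rewrite series_expS lerDl.
by rewrite divr_ge0 ?exprn_ge0.
Qed.

Lemma etail_cvg (x : R) : etail N x @[N --> \oo] --> (0 : R).
Proof.
rewrite -(subrr (expR x)); apply: cvgB; first exact: cvg_cst.
exact: is_cvg_series_exp_coeff.
Qed.

(** The terms of index at least N increase with x >= 0. This bounds the remainders at all points t z
    of the segment [0, z] by the one at z. *)
Lemma etail_le (x y : R) N : 0 <= y -> y <= x -> etail N y <= etail N x.
Proof.
move=> y0 yx; have x0 := le_trans y0 yx.
rewrite /etail lerBlDr; apply: limr_le; first exact: is_cvg_series_exp_coeff.
exists N => // M /= /subnK <-; rewrite -lerBlDr; move: (M - N)%N => k.
apply: (@le_trans _ _ (series (exp_coeff x) (k + N) - series (exp_coeff x) N)).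
  elim: k => [|k IH]; first by rewrite !subrr.
  rewrite addSn !series_expS ![_ + _ / _ - _]addrAC lerD// ler_wpM2r// lerXn2r//.
by rewrite lerD2r series_exp_le.
Qed.

Definition psum a N z : R[i] := \sum_(n < N) a n / n`!%:R * z ^+ n.

Definition egf f a := forall z, (psum a N z : C) @[N --> \oo] --> (f z : C).

Definition coef_bounded a A D := forall n, normc (a n) <= A * D ^+ n.

Lemma coef_bounded_ge0 a A D : coef_bounded a A D -> 0 <= A.
Proof. by move=> /(_ 0%N); rewrite mulr1; exact: le_trans (normc_ge0 _). Qed.

Lemma psumS a N z : psum a N.+1 z = psum a N z + a N / N`!%:R * z ^+ N.
Proof. by rewrite /psum big_ord_recr. Qed.

Lemma normc_term a A D n z : coef_bounded a A D ->
  normc (a n / n`!%:R * z ^+ n) <= A * ((D * normc z) ^+ n / n`!%:R).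
Proof.
move=> aAD; rewrite !normcM normcV normc_nat normcX exprMn.
have -> : A * (D ^+ n * normc z ^+ n / n`!%:R) =
   A * D ^+ n / n`!%:R * normc z ^+ n by rewrite mulrA mulrA mulrAC.
by rewrite !ler_wpM2r ?exprn_ge0 ?normc_ge0 ?invr_ge0//; exact: aAD.
Qed.

Lemma normc_cvg_le (x : nat -> R[i]) (l : R[i]) (k : R) :
  (x N : C) @[N --> \oo] --> (l : C) -> (\forall N \near \oo, normc (x N) <= k) ->
  normc l <= k.
Proof.
move=> /cvgrPdist_lt xl xk; apply/ler_addgt0Pr => e e0.
have := xl e%:C; rewrite ltcR => /(_ e0) xe.
near \oo => N.
have H1 : normc (x N) <= k by near: N.
have H2 : normc (l - x N) < e by rewrite -ltcR; near: N.
rewrite -(subrK (x N) l) addrC; apply: (le_trans (le_normcD _ _)).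
by rewrite addrC [leRHS]addrC lerD// ltW.
Unshelve. all: by end_near. Qed.

Lemma egf_tail f a A D : coef_bounded a A D -> 0 <= D -> egf f a ->
  forall z N, normc (f z - psum a N z) <= A * etail N (D * normc z).
Proof.
move=> aAD D0 fa z N; have A0 := coef_bounded_ge0 aAD.
have x0 : 0 <= D * normc z by rewrite mulr_ge0// normc_ge0.
apply: (@normc_cvg_le (fun M => psum a M z - psum a N z)).
  by apply: (@cvgB _ C); [exact: fa|exact: cvg_cst].
exists N => // M /= /subnK <-; move: (M - N)%N => k.
apply: (@le_trans _ _ (A * (series (exp_coeff (D * normc z)) (k + N) -
   series (exp_coeff (D * normc z)) N))); last first.
  by rewrite ler_wpM2l// lerD2r series_exp_le.
elim: k => [|k IH]; first by rewrite !subrr normc0 mulr0.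
rewrite addSn psumS series_expS ![_ + _ - _]addrAC mulrDr.
by apply: (le_trans (le_normcD _ _)); rewrite lerD// normc_term.
Qed.

Lemma egf_bound f a A D : coef_bounded a A D -> 0 <= D -> egf f a ->
  forall z, normc (f z) <= A * expR (D * normc z).
Proof.
move=> aAD D0 fa z; have := egf_tail aAD D0 fa z 0.
by rewrite /psum big_ord0 subr0 /etail /series /= big_nil subr0.
Qed.

Lemma egf_at0 f a : egf f a -> f 0 = a 0%N.
Proof.
move=> /(_ 0) H; apply/eqP; rewrite -subr_eq0; apply/eqP/eq0_normc/eqP.
rewrite eq_le normc_ge0 andbT.
apply: (@normc_cvg_le (fun M => psum a M 0 - a 0%N)).
  by apply: (@cvgB _ C); [exact: H|exact: cvg_cst].
exists 1%N => // -[//|M] _; rewrite /psum big_ord_recl expr0 mulr1 fact0 divr1.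
rewrite big1 ?addr0 ?subrr ?normc0// => i _.
by rewrite expr0n mulr0.
Qed.

Lemma cvg_complex (x : nat -> R[i]) (u v : R) :
  complex.Re (x N) @[N --> \oo] --> u -> complex.Im (x N) @[N --> \oo] --> v ->
  (x N : C) @[N --> \oo] --> ((u +i* v : R[i]) : C).
Proof.
move=> /cvgrPdist_lt xu /cvgrPdist_lt xv; apply/cvgrPdist_lt => e0 e00.
have [e e_gt0 ->] := gt0_complexE e00.
have e2 : 0 < e / 2 by rewrite divr_gt0.
near=> N; rewrite normcE ltcR.
apply: (le_lt_trans (ler_normc_ReIm _)).
have -> : complex.Re (u +i* v - x N) = u - complex.Re (x N) by case: (x N).
have -> : complex.Im (u +i* v - x N) = v - complex.Im (x N) by case: (x N).
rewrite [ltRHS]splitr ltrD//; near: N; [exact: xu|exact: xv].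
Unshelve. all: by end_near. Qed.

Lemma egf_exists a A D : coef_bounded a A D -> 0 <= D -> exists f, egf f a.
Proof.
move=> aAD D0; have A0 := coef_bounded_ge0 aAD.
suff /choice[f Hf] : forall z, exists l : R[i],
  (psum a N z : C) @[N --> \oo] --> (l : C) by exists f.
move=> z; have part (p : R[i] -> R) : (forall u v, p (u + v) = p u + p v) -> p 0 = 0 ->
    (forall u, `|p u| <= normc u) -> cvg (p (psum a N z) @[N --> \oo]).
  move=> pD p0 pn; pose u n := p (a n / n`!%:R * z ^+ n).
  have -> : (fun N => p (psum a N z)) = series u.
    apply/funext; elim => [|N IH]; first by rewrite /psum big_ord0 /series /= big_nil.
    by rewrite psumS pD IH /series /= big_nat_recr.
  apply: normed_cvg.
  apply: (@series_le_cvg _ _ (fun n => A * exp_coeff (D * normc z) n)) => [n|n|n|].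
  - exact: normr_ge0.
  - by rewrite mulr_ge0// divr_ge0// exprn_ge0// mulr_ge0// normc_ge0.
  - exact: le_trans (pn _) (normc_term _ _ aAD).
  by apply: is_cvg_seriesZ; exact: is_cvg_series_exp_coeff.
have cr := part (@complex.Re R) (@ReD R) erefl (@ler_Re_normc R).
have ci := part (@complex.Im R) (@ImD R) erefl (@ler_Im_normc R).
by exists (limn (fun N => complex.Re (psum a N z)) +i* limn (fun N => complex.Im (psum a N z)));
  exact: cvg_complex.
Qed.

(** The quantity e_n inside the modulus satisfies e_(n+1) = (z + h) e_n + (n + 2) h^2 z^(n+1). The
    factor (n + 2)(n + 1) is what later turns 1/(n + 2)! into 1/n!. *)
Lemma second_difference z h (rho : R) n : normc z <= rho -> normc (z + h) <= rho ->
  normc ((z + h) ^+ n.+2 - z ^+ n.+2 - n.+2%:R * h * z ^+ n.+1) <=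
  normc h ^+ 2 * (n.+2 * n.+1)%:R * rho ^+ n.
Proof.
move=> zr zhr; have rho0 := le_trans (normc_ge0 z) zr.
elim: n => [|n IH].
  have -> : (z + h) ^+ 2 - z ^+ 2 - 2 * h * z ^+ 1 = h ^+ 2 by ring.
  by rewrite normcX expr0 mulr1 ler_peMr ?exprn_ge0 ?normc_ge0// ler1n.
have -> : (z + h) ^+ n.+3 - z ^+ n.+3 - n.+3%:R * h * z ^+ n.+2 =
   (z + h) * ((z + h) ^+ n.+2 - z ^+ n.+2 - n.+2%:R * h * z ^+ n.+1) +
   h ^+ 2 * n.+2%:R * z ^+ n.+1.
  by rewrite ![_ ^+ n.+3]exprS -[n.+3]addn1 natrD !(exprS z n.+1); ring.
apply: (le_trans (le_normcD _ _)); rewrite !normcM !normcX normc_nat.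
have H1 := ler_pM (normc_ge0 _) (normc_ge0 _) zhr IH.
have H2 : normc h ^+ 2 * n.+2%:R * normc z ^+ n.+1 <=
    normc h ^+ 2 * n.+2%:R * rho ^+ n.+1.
  by rewrite ler_wpM2l ?mulr_ge0 ?exprn_ge0 ?normc_ge0// lerXn2r// ?nnegrE ?normc_ge0.
apply: (le_trans (lerD H1 H2)).
have -> : rho * (normc h ^+ 2 * (n.+2 * n.+1)%:R * rho ^+ n) +
    normc h ^+ 2 * n.+2%:R * rho ^+ n.+1 =
    normc h ^+ 2 * (n.+2 * n.+2)%:R * rho ^+ n.+1.
  have e : n.+2%:R = n.+1%:R + 1 :> R by rewrite -[in LHS]addn1 natrD.
  by rewrite !natrM [rho ^+ n.+1]exprS e; ring.
rewrite ler_wpM2r ?exprn_ge0// ler_wpM2l ?exprn_ge0 ?normc_ge0// ler_nat.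
exact: leq_mul.
Qed.

(** Terms of index 0 and 1 are affine and leave no error, hence the shift by 2. The others are
    bounded through [second_difference] by A D^2 |h|^2 (D rho)^n / n!, whose sum is dominated by the
    exponential, uniformly in M. *)
Lemma psum_derive a A D z h (rho : R) M : coef_bounded a A D -> 0 <= D ->
  normc z <= rho -> normc (z + h) <= rho ->
  normc (psum a M.+2 (z + h) - psum a M.+2 z - psum (a \o succn) M.+1 z * h) <=
  A * D ^+ 2 * expR (D * rho) * normc h ^+ 2.
Proof.
move=> aAD D0 zr zhr; have A0 := coef_bounded_ge0 aAD.
have rho0 := le_trans (normc_ge0 z) zr.
apply: (@le_trans _ _ (A * D ^+ 2 * series (exp_coeff (D * rho)) M * normc h ^+ 2)).
  elim: M => [|M IH].
    rewrite /psum !big_ord_recl !big_ord0 /= /series /= big_nil mulr0 mul0r.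
    rewrite /bump /= !fact0 factS fact0 muln1 !expr1 !expr0 !addr0 !mulr1 !divr1.
    by rewrite (_ : _ - _ = 0) ?normc0//; ring.
  rewrite psumS (psumS a M.+2 z) (psumS (a \o succn) M.+1) series_expS.
  set P := psum a M.+2 (z + h) in IH *; set Q := psum a M.+2 z in IH *.
  set S := psum (a \o succn) M.+1 z in IH *.
  have F0 : (M.+1)`!%:R != 0 :> R[i] by rewrite pnatr_eq0 -lt0n fact_gt0.
  have -> : P + a M.+2 / (M.+2)`!%:R * (z + h) ^+ M.+2 -
      (Q + a M.+2 / (M.+2)`!%:R * z ^+ M.+2) -
      (S + (a \o succn) M.+1 / (M.+1)`!%:R * z ^+ M.+1) * h =
      (P - Q - S * h) + a M.+2 / (M.+2)`!%:R *
      ((z + h) ^+ M.+2 - z ^+ M.+2 - M.+2%:R * h * z ^+ M.+1).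
    have G0 : M.+2%:R != 0 :> R[i] by rewrite pnatr_eq0.
    rewrite [(M.+2)`!]factS natrM /=; move: (M.+2%:R) G0 => t G0; field.
    by rewrite F0 G0.
  apply: (le_trans (le_normcD _ _)); rewrite [in leRHS]mulrDr [in leRHS]mulrDl lerD//.
  rewrite !normcM normcV normc_nat.
  have H := second_difference M zr zhr.
  have G0 : 0 < (M.+2)`!%:R :> R by rewrite ltr0n fact_gt0.
  have H2 : normc (a M.+2) / (M.+2)`!%:R <= A * D ^+ M.+2 / (M.+2)`!%:R.
    by rewrite ler_wpM2r ?invr_ge0//; exact: aAD.
  apply: (le_trans (ler_pM _ _ H2 H)); rewrite ?mulr_ge0 ?invr_ge0 ?normc_ge0//.
  apply: eq_ler; rewrite !factS !natrM !exprS exprMn.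
  have G1 : M`!%:R != 0 :> R by rewrite pnatr_eq0 -lt0n fact_gt0.
  have G2 : M.+1%:R != 0 :> R by rewrite pnatr_eq0.
  have G3 : M.+2%:R != 0 :> R by rewrite pnatr_eq0.
  move: (M.+1%:R) (M.+2%:R) (M`!%:R) G1 G2 G3 => x y t G1 G2 G3.
  by field; rewrite G1 G2 G3.
rewrite ler_wpM2r ?exprn_ge0 ?normc_ge0// ler_wpM2l ?mulr_ge0 ?exprn_ge0//.
by rewrite series_exp_le// mulr_ge0.
Qed.

Lemma egf_approx f g a A D z : coef_bounded a A D -> 0 <= D -> egf f a ->
  egf g (a \o succn) -> affine_approx f z (g z).
Proof.
move=> aAD D0 fa ga e e0; have A0 := coef_bounded_ge0 aAD.
pose K := A * D ^+ 2 * expR (D * (normc z + 1)).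
have K0 : 0 <= K by rewrite /K !mulr_ge0 ?exprn_ge0 ?expR_ge0.
(* The 1 keeps z + h in the disc of radius |z| + 1 used in [K]; the other bound turns K |h|^2 into e
   |h|. *)
have r0 : 0 < Num.min 1 (e / (K + 1)) by rewrite lt_min ltr01 divr_gt0// ltr_wpDl.
exists (Num.min 1 (e / (K + 1))) => // w; rewrite lt_min => /andP[w1 we].
pose h := w - z; have wE : w = z + h by rewrite /h addrC subrK.
rewrite -/h in w1 we *; rewrite {1}wE.
apply: (@le_trans _ _ (K * normc h ^+ 2)); last first.
  rewrite expr2 mulrA ler_wpM2r ?normc_ge0// .
  have : (K + 1) * normc h <= e by rewrite mulrC -ler_pdivlMr ?ltr_wpDl// ltW.
  by apply: le_trans; rewrite ler_wpM2r ?normc_ge0// lerDl.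
apply: (@normc_cvg_le (fun M =>
  psum a M.+2 (z + h) - psum a M.+2 z - psum (a \o succn) M.+1 z * h)).
  have shift (u : nat -> C) (l : C) : u N @[N --> \oo] --> l -> u N.+1 @[N --> \oo] --> l.
    by rewrite -[X in X -> _]cvg_shiftS.
  have g1 := shift _ _ (ga z).
  have gh : (psum (a \o succn) M.+1 z * h : C) @[M --> \oo] --> (g z * h : C).
    by apply: (@cvgM R[i] _ _ _ _ _ _ _ g1); exact: cvg_cst.
  have f1 := shift _ _ (shift _ _ (fa (z + h))).
  have f2 := shift _ _ (shift _ _ (fa z)).
  exact: (@cvgB _ C _ _ _ _ _ _ _ (@cvgB _ C _ _ _ _ _ _ _ f1 f2) gh).
apply: nearW => M; apply: psum_derive => //; first by rewrite lerDl.
by apply: (le_trans (le_normcD _ _)); rewrite lerD2l ltW.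
Qed.

Lemma coef_bounded_shift a A D : coef_bounded a A D ->
  coef_bounded (a \o succn) (A * D) D.
Proof. by move=> aAD n /=; rewrite -mulrA -exprS. Qed.

Lemma egf_derive a A D f : coef_bounded a A D -> 0 <= D -> egf f a ->
  egf (derive1 (f : C -> C)) (a \o succn).
Proof.
move=> aAD D0 fa; have [g ga] := egf_exists (coef_bounded_shift aAD) D0.
rewrite (_ : derive1 (f : C -> C) = (g : C -> C))//; apply/funext => z; apply: derive1_approx.
exact: egf_approx ga.
Qed.

(** Without division by n!: a coefficient of the Borel transform, and the number that membership in
    [vanishing_subspace] sets to 0. *)
Definition tcoef f n : R[i] := derive1n n (f : C -> C) 0.

(** Each differentiation shifts the sequence, keeping D and multiplying the constant A by D. Besides
    computing derivatives, this gives uniqueness of the coefficients, from which linearity and the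
    action of J are read off. *)
Lemma egf_tcoef a A D f : coef_bounded a A D -> 0 <= D -> egf f a ->
  forall n, tcoef f n = a n.
Proof.
move=> aAD D0 fa n; rewrite /tcoef.
suff [A' [_ H]] : exists A', coef_bounded (fun k => a (k + n)%N) A' D /\
    egf (derive1n n (f : C -> C)) (fun k => a (k + n)%N).
  exact: egf_at0 H.
elim: n => [|n [A' [aA' IH]]].
  exists A; rewrite (_ : (fun k => a (k + 0)%N) = a)//.
  by apply/funext => k; rewrite addn0.
exists (A' * D).
rewrite (_ : (fun k => a (k + n.+1)%N) = (fun k => a (k + n)%N) \o succn); last first.
  by apply/funext => k; rewrite /= addnS.
split; first exact: coef_bounded_shift aA'.
by rewrite derive1nS; exact: egf_derive IH.
Qed.

End exponential_generating_functions.

(** * Coefficients of functions of exponential type, termwise integration *)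

Section exponential_type.
Context {R : realType}.
Local Notation C := (R[i]^o).
Implicit Types (f g : R[i] -> R[i]) (a : nat -> R[i]) (A D : R) (z w : R[i]).

(** Cancels the n! of the coefficients against r^n in Cauchy's inequality at r = n + 1, a choice of
    r that stays positive for n = 0. *)
Lemma fact_le_expn n : (n`! <= n.+1 ^ n)%N.
Proof.
elim: n => [//|n IH]; rewrite factS expnS; apply: leq_mul; first exact: leqnSn.
by apply: (leq_trans IH); case: n {IH} => // n; rewrite leq_exp2r.
Qed.

(** With r = n + 1, Cauchy's inequality bounds the n-th coefficient by a multiple of n! exp(2 A (n +
    1)) / (n + 1)^n <= D^(n+1), where D = exp(2 A). Convergence to f at w uses instead a fixed
    square, of half-side |w| + 1. *)
Lemma exp_type_egf f A B : entire f -> 0 <= A ->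
  (forall z, normc (f z) <= B * expR (A * normc z)) ->
  exists a K D, [/\ 1 <= D, coef_bounded a K D & egf f a].
Proof.
move=> hf A0 fB; pose a n := n`!%:R * (cauchy_coef f n / kappa).
have nk0 : 0 < normc (kappa : R[i]) by rewrite normc_gt0 kappa_neq0.
have B0 : 0 <= B.
  by have := fB 0; rewrite normc0 mulr0 expR0 mulr1; exact: le_trans (normc_ge0 _).
pose D := expR (A * 2).
have edgeB r : 0 < r -> forall z, edge (square r) z ->
    normc (f z) <= B * expR (A * (2 * r)).
  move=> r0 z /(edge_square_le r0) zr; apply: (le_trans (fB z)).
  by rewrite ler_wpM2l// ler_expR ler_wpM2l.
exists a, (16 * B * D / normc kappa), D; split.
- by rewrite -expR0 ler_expR mulr_ge0.
- move=> n; rewrite /a !normcM normcV normc_nat.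
  have r0 : 0 < n.+1%:R :> R by rewrite ltr0n.
  have := cauchy_coef_le n hf r0 (edgeB _ r0).
  have -> : expR (A * (2 * n.+1%:R)) = D ^+ n.+1.
    by rewrite mulrA mulrC expRM_natl.
  have : n`!%:R <= n.+1%:R ^+ n :> R by rewrite -natrX ler_nat fact_le_expn.
  move: (normc (cauchy_coef f n)) (normc_ge0 (cauchy_coef f n)) => c c0 Hn Hc.
  rewrite mulrA ler_pdivrMr// .
  have -> : 16 * B * D / normc kappa * D ^+ n * normc (kappa : R[i]) =
     16 * (B * D ^+ n.+1) by rewrite exprS; field; rewrite gt_eqF.
  apply: (@le_trans _ _ (n.+1%:R ^+ n * c)); first by rewrite ler_wpM2r.
  by rewrite mulrC -ler_pdivlMr ?exprn_gt0.
move=> w; apply/cvgrPdist_lt => e0 e00.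
have [e e_gt0 ->] := gt0_complexE e00.
pose r := normc w + 1; have w0 := normc_ge0 w.
have wr : normc w < r by rewrite /r ltrDl.
have r0 : 0 < r by rewrite /r ltr_wpDl.
pose K := 16 * (B * expR (A * (2 * r))) * r / (r - normc w) / normc (kappa : R[i]).
have := @cvg_geometric R K (normc w / r).
rewrite ger0_norm ?divr_ge0 ?(ltW r0)// ltr_pdivrMr// mul1r => /(_ wr).
move=> /cvgrPdist_lt/(_ _ e_gt0); apply: filterS => N.
rewrite sub0r normrN normcE ltcR => H.
have := taylor_estimate N hf wr (edgeB _ r0).
have -> : psum a N w = \sum_(n < N) cauchy_coef f n / kappa * w ^+ n.
  apply: eq_bigr => n _; have F0 : n`!%:R != 0 :> R[i].
    by rewrite pnatr_eq0 -lt0n fact_gt0.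
  by rewrite /a [n`!%:R * _]mulrC mulfK.
move=> /le_lt_trans; apply; exact: le_lt_trans (ler_norm _) H.
Qed.

Lemma Rintegral_exprn n :
  \int[lebesgue_measure]_(t in `[0, 1]) t ^+ n = n.+1%:R^-1 :> R.
Proof.
pose F : R -> R := n.+1%:R^-1 *: (@GRing.exp R ^~ n.+1).
have n0 : n.+1%:R != 0 :> R by rewrite pnatr_eq0.
have dF (t : R) : derivable F t 1 by apply: derivableZ; exact: exprn_derivable.
have DF (t : R) : 'D_1 F t = t ^+ n.
  rewrite deriveZ ?exp_derive; last exact: exprn_derivable.
  by rewrite /GRing.scale /= mulr1 mulKf.
have cF : continuous F.
  by move=> t; apply/differentiable_continuous/derivable1_diffP.
rewrite /Rintegral (@continuous_FTC2 _ _ F)//=.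
- by rewrite /F !fctE /GRing.scale /= expr1n expr0n /= mulr0 mulr1 subr0.
- by apply: continuous_subspaceT => t; exact: exprn_continuous.
- split=> [t _||]; first exact: dF.
  + exact/cvg_at_right_filter/cF.
  + exact/cvg_at_left_filter/cF.
- by move=> t _; rewrite derive1E DF.
Qed.

Lemma cintegrable_exprn n : cintegrable (fun t : R => t%:C ^+ n) 0 1.
Proof.
have -> : (fun t : R => t%:C ^+ n) = fun t => (t ^+ n)%:C.
  by apply/funext => t; rewrite rmorphXn.
apply: cintegrable_cont => t _.
apply: (@continuous_comp R R C (fun t => t ^+ n) (fun t => (t%:C : C)) t).
  exact: exprn_continuous.
exact: continuous_hline.
Qed.

Lemma cint_exprn n : cint (fun t : R => t%:C ^+ n) 0 1 = n.+1%:R^-1.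
Proof.
have -> : (fun t : R => t%:C ^+ n) = fun t => (t ^+ n)%:C.
  by apply/funext => t; rewrite rmorphXn.
rewrite /cint /= Rintegral_exprn (_ : \int[_]_(_ in _) 0 = 0).
  by rewrite -[LHS]/(n.+1%:R^-1)%:C fmorphV rmorph_nat.
by rewrite /Rintegral integral0.
Qed.

(** The sequence of x times the Borel transform of a. *)
Definition preseq a n : R[i] := if n is m.+1 then a m else 0.

(** Partial sums integrate exactly, since z times the integral of (t z)^n / n! over [0, 1] is
    z^(n+1) / (n + 1)!. The remainder is controlled uniformly on [0, z] by [etail] at D |z|, which
    allows the passage to the limit. *)
Lemma integration_op_egf f a A D : entire f -> coef_bounded a A D -> 0 <= D ->
  egf f a -> egf (integration_op f) (preseq a).
Proof.
move=> hf aAD D0 fa z; have A0 := coef_bounded_ge0 aAD.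
have JE : integration_op f z = cint (fun t => z * f (t%:C * z)) 0 1.
  rewrite /integration_op -[LHS]/(cint (fun t => f (0 + t%:C * (z - 0)) * (z - 0)) 0 1).
  by apply: eq_cint => t _; rewrite add0r subr0 mulrC.
have if_ : cintegrable (fun t => f (t%:C * z)) 0 1.
  apply: cintegrable_cont => t _.
  apply: (@continuous_comp R C C (fun t : R => (t%:C * z : C)) (f : C -> C) t).
    apply: (@continuous_comp R C C (fun t : R => (t%:C : C)) (fun u : C => u * z : C) t).
      exact: continuous_hline.
    apply: derivable_continuous_at.
    apply: (@derivable_mul _ (fun u => u) (fun=> z)); first exact: derivable_id.
    exact: derivable_cst.
  exact/derivable_continuous_at/hf.
have ip N : cintegrable (fun t => psum a N (t%:C * z)) 0 1 /\
    cint (fun t => z * psum a N (t%:C * z)) 0 1 = psum (preseq a) N.+1 z.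
  have pS M : (fun t : R => psum a M.+1 (t%:C * z)) =
      (fun t : R => psum a M (t%:C * z) + a M / M`!%:R * z ^+ M * t%:C ^+ M).
    by apply/funext => t; rewrite psumS exprMn mulrA mulrAC.
  elim: N => [|N [IH1 IH2]].
    have p0 : (fun t : R => psum a 0 (t%:C * z)) = fun=> 0.
      by apply/funext => t; rewrite /psum big_ord0.
    have i0 : cintegrable (fun=> 0 : R[i]) (0 : R) 1.
      by apply: cintegrable_cont => t _; exact: cvg_cst.
    rewrite p0; split=> //; rewrite cintZ p0//.
    by rewrite cint_cst// mul0r mulr0 /psum big_ord1 /= !mul0r.
  rewrite pS; split.
    by apply: cintegrableD => //; apply: cintegrableZ; exact: cintegrable_exprn.
  rewrite cintZ; last first.
    by rewrite pS; apply: cintegrableD => //; apply: cintegrableZ; exact: cintegrable_exprn.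
  rewrite pS cintD//; last by apply: cintegrableZ; exact: cintegrable_exprn.
  rewrite mulrDr -cintZ// IH2 cintZ ?cint_exprn; last exact: cintegrable_exprn.
  rewrite [RHS]psumS; congr (_ + _); rewrite /= factS natrM.
  have F0 : N`!%:R != 0 :> R[i] by rewrite pnatr_eq0 -lt0n fact_gt0.
  have G0 : N.+1%:R != 0 :> R[i] by rewrite pnatr_eq0.
  move: (N.+1%:R) G0 => t G0; rewrite exprS; field; by rewrite F0 G0.
have est N : normc (integration_op f z - psum (preseq a) N.+1 z) <=
    2 * (normc z * A) * etail N (D * normc z).
  have [ip1 ip2] := ip N; rewrite -ip2 JE -cintB; [|exact: cintegrableZ..].
  rewrite (_ : 2 * (normc z * A) * _ =
    2 * (normc z * (A * etail N (D * normc z)) * (1 - 0))); last by rewrite subr0; ring.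
  apply: cint_bound => //; first by apply: cintegrableB; exact: cintegrableZ.
  move=> t /andP[t0 t1]; rewrite -mulrBr normcM ler_wpM2l ?normc_ge0//.
  apply: le_trans (egf_tail aAD D0 fa _ _) _; rewrite ler_wpM2l//.
  rewrite normcM normc_real ger0_norm// etail_le ?mulr_ge0 ?normc_ge0//.
  by rewrite ler_wpM2l// ler_piMl// normc_ge0.
rewrite -(cvg_shiftS (fun N => psum (preseq a) N z : C)).
apply/cvgrPdist_lt => e0 e00.
have [e e_gt0 ->] := gt0_complexE e00.
have H : 2 * (normc z * A) * etail N (D * normc z) @[N --> \oo] --> (0 : R).
  rewrite -(mulr0 (2 * (normc z * A))); apply: cvgM; first exact: cvg_cst.
  exact: etail_cvg.
move: H => /cvgrPdist_lt/(_ _ e_gt0); apply: filterS => N.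
rewrite sub0r normrN normcE ltcR; apply: le_lt_trans.
exact: le_trans (est N) (ler_norm _).
Qed.

End exponential_type.

(** * Taylor coefficients on [expC] and approximation within one step *)

Section taylor_coefficients.
Context {R : realType}.
Local Notation C := (R[i]^o).
Implicit Types f g h : expC R.

Lemma coef_bounded_mono (a : nat -> R[i]) (A D D' : R) : coef_bounded a A D ->
  0 <= D -> D <= D' -> coef_bounded a A D'.
Proof.
move=> aAD D0 DD' n; apply: (le_trans (aAD n)).
rewrite ler_wpM2l ?(coef_bounded_ge0 aAD)// lerXn2r// ?nnegrE//.
exact: le_trans DD'.
Qed.

Lemma expC_entire f : entire (val f).
Proof. by have /asboolP[ef _] := valP f. Qed.

Lemma expC_egf f : exists A D, [/\ 1 <= D,
  coef_bounded (tcoef (val f)) A D & egf (val f) (tcoef (val f))].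
Proof.
have /asboolP[_ [A A0 [B fB]]] := valP f.
have [|a [K [D [D1 aKD fa]]]] := @exp_type_egf _ (val f) A B (@expC_entire f) (ltW A0).
  move=> z; rewrite -ler_pdivrMr ?expR_gt0// -expRN.
  by apply: fB; exists z.
have -> : tcoef (val f) = a.
  by apply/funext => n; apply: egf_tcoef aKD _ fa _; exact: le_trans D1.
by exists K, D.
Qed.

(** The combined sequence is bounded with the common ratio max D E and its series sums to f + k g,
    so uniqueness of the coefficients applies. *)
Lemma tcoefD f g k n :
  tcoef (val (f + k *: g)) n = tcoef (val f) n + k * tcoef (val g) n.
Proof.
have [A [D [D1 fb fa]]] := expC_egf f; have [B [E [E1 gb ga]]] := expC_egf g.
pose a n := tcoef (val f) n + k * tcoef (val g) n.
pose F := Num.max D E.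
have F0 : 0 <= F by rewrite le_max (le_trans ler01 D1).
have D0 := le_trans ler01 D1; have E0 := le_trans ler01 E1.
have fF : coef_bounded (tcoef (val f)) A F.
  by apply: coef_bounded_mono fb D0 _; rewrite le_max lexx.
have gF : coef_bounded (tcoef (val g)) B F.
  by apply: coef_bounded_mono gb E0 _; rewrite le_max lexx orbT.
have aF : coef_bounded a (A + normc k * B) F.
  move=> m; apply: (le_trans (le_normcD _ _)); rewrite normcM mulrDl.
  apply: lerD; first exact: fF.
  by rewrite -mulrA; apply: ler_wpM2l; [exact: normc_ge0|exact: gF].
have aE : egf (fun z => val f z + k * val g z) a.
  move=> z; rewrite (_ : (fun N => psum a N z : C) = fun N => psum (tcoef (val f)) N z +
    k * psum (tcoef (val g)) N z); last first.
    apply/funext => N; rewrite /psum mulr_sumr -big_split; apply: eq_bigr => i _.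
    by rewrite /a /=; ring.
  have kg : (k * psum (tcoef (val g)) N z : C) @[N --> \oo] --> (k * val g z : C).
    apply: (@cvgM R[i] _ _ _ (fun=> k)); first exact: cvg_cst.
    exact: ga.
  exact: (@cvgD _ C _ _ _ _ _ _ _ (fa z) kg).
exact: (egf_tcoef aF F0 aE n).
Qed.

Lemma tcoef_integration_op f n :
  tcoef (integration_op (val f)) n = preseq (tcoef (val f)) n.
Proof.
have [A [D [D1 fb fa]]] := expC_egf f; have D0 := le_trans ler01 D1.
have Jf := integration_op_egf (@expC_entire f) fb D0 fa.
apply: (egf_tcoef (A := A) (D := D) _ D0 Jf) => -[|m]; rewrite /preseq.
  by rewrite normc0 mulr_ge0// (coef_bounded_ge0 fb).
(* [1 <= D] lets the shifted sequence keep the same constants. *)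
apply: (le_trans (fb m)); rewrite ler_wpM2l ?(coef_bounded_ge0 fb)//.
by rewrite exprS ler_peMl// exprn_ge0.
Qed.

Lemma expC_eq0 f : (forall n, tcoef (val f) n = 0) -> f = 0.
Proof.
move=> f0; have [A [D [D1 fb fa]]] := expC_egf f.
have b0 : coef_bounded (tcoef (val f)) 0 D by move=> n; rewrite f0 normc0 mul0r.
apply/val_inj/funext => z; apply: eq0_normc; apply/eqP.
rewrite eq_le normc_ge0 andbT.
by have := egf_bound b0 (le_trans ler01 D1) fa z; rewrite mul0r.
Qed.

(** A neighborhood of f contains f + V, where V meets each step in a neighborhood of 0. Choosing a
    step whose weight exceeds D, the functions r have norm at most e there, so -r lies in V for e
    small. *)
Lemma expC_closure (M : set (expC R)) f (D : R) : closed M -> 0 <= D ->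
  (forall e : R, 0 < e -> exists2 r : expC R, M (f - r) &
    forall z, normc (val r z) <= e * expR (D * normc z)) -> M f.
Proof.
move=> cM D0 H; rewrite ((closure_id M).1 cM) => U /expC_nbhs[V [_ nV] VU].
pose n := Num.truncn D; have Dn : D <= n.+1%:R by exact/ltW/truncnS_gt.
have /nbhs_ballP[e0 /= e00 eV] := nV n.
have [e e_gt0 e0E] := gt0_complexE e00; rewrite e0E in eV.
have [r Mr rb] := H (e / 2) (divr_gt0 e_gt0 (ltr0n _ 2)).
have rw z : weighted n.+1%:R (val r) z <= e / 2.
  rewrite /weighted expRN ler_pdivrMr ?expR_gt0//; apply: (le_trans (rb z)).
  rewrite ler_wpM2l ?divr_ge0// ?(ltW e_gt0)// ler_expR ler_wpM2r ?normc_ge0//.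
have rn : val r \in exp_step_pred n.
  apply/asboolP; split; first exact: expC_entire.
  by exists (e / 2) => _ [z _ <-].
pose s : expC_step R n := Sub (val r) rn.
exists (f - r); split=> //; apply: VU.
have -> : - r = step_incl (- s) by apply/val_inj.
apply: eV; rewrite -ball_normE /= sub0r opprK.
rewrite -[`|s|]/((step_sup s)%:C) ltcR.
apply: (@le_lt_trans _ _ (e / 2)); last by lra.
exact: step_sup_le.
Qed.

End taylor_coefficients.

(** * Closed invariant subspaces of the integration operator *)

Theorem theorem5p3 (R : realType) (M : set (expC R)) :
  proper_subspace M -> closed M -> integration_invariant M ->
  exists2 K : nat, (1 <= K)%N & M = vanishing_subspace K.
Proof.
move=> [[M0 Mlin] Mn0 MnT] cM JM.
have {}M0 : M 0 by move: M0; rewrite inE.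
have {}Mlin k u v : M u -> M v -> M (k *: u + v).
  move=> Mu Mv; have := Mlin k u v; rewrite !inE => H.
  by apply: H.
pose P n := `[< exists2 f, M f & tcoef (val f) n != 0 >].
have exP : exists n, P n.
  apply: contrapT => nP; apply: Mn0; apply/seteqP; split => [f Mf|_ ->//] /=.
  apply: expC_eq0 => n; apply/eqP/negPn/negP => fn.
  by apply: nP; exists n; apply/asboolP; exists f.
case: (ex_minnP exP) => K /asboolP[f Mf fK] Kmin.
have Mlow g n : M g -> (n < K)%N -> tcoef (val g) n = 0.
  move=> Mg nK; apply/eqP/negPn/negP => gn.
  by have := Kmin n; rewrite leqNgt nK => H; apply/notF/H/asboolP; exists g.
suff E : M = vanishing_subspace K.
  (* [vanishing_subspace 0] imposes no condition, so K = 0 would make M the whole space. *)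
  exists K => //; rewrite lt0n; apply/eqP => K0; apply: MnT.
  by rewrite E K0; apply/seteqP; split.
apply/seteqP; split => [g Mg j jK|h Vh]; first exact: Mlow.
have hlow n : (n < K)%N -> tcoef (val h) n = 0 by exact: Vh.
(* The witness is J^N f: invariance keeps it in M, and only its coefficients, those of f moved right
   by N, are used. *)
have iterJ N : exists g, [/\ M g, forall n, (n < N)%N -> tcoef (val g) n = 0 &
    forall n, tcoef (val g) (N + n) = tcoef (val f) n].
  elim: N => [|N [g [Mg glow gE]]]; first by exists f; split.
  have [g' Mg' g'E] : exists2 g', M g' & val g' = integration_op (val g).
    by have [g' Mg' E] := JM _ (ex_intro2 _ _ g Mg erefl); exists g'.
  exists g'; split => // [[|n] nN|n]; rewrite g'E tcoef_integration_op//=.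
  exact: glow.
have [A [D1 [D11 fb _]]] := expC_egf f; have [B [D2 [D21 hb _]]] := expC_egf h.
pose D := Num.max D1 D2.
have D_ge1 : 1 <= D by rewrite le_max D11.
have D_ge0 := le_trans ler01 D_ge1.
have {}fb : coef_bounded (tcoef (val f)) A D.
  by apply: coef_bounded_mono fb _ _; [exact: le_trans D11|rewrite le_max lexx].
have {}hb : coef_bounded (tcoef (val h)) B D.
  by apply: coef_bounded_mono hb _ _; [exact: le_trans D21|rewrite le_max lexx orbT].
have A0 := coef_bounded_ge0 fb; have B0 := coef_bounded_ge0 hb.
have fK0 : 0 < normc (tcoef (val f) K) by rewrite normc_gt0.
(* Past order K, the coefficients of f are at most [al] |f_K| D^i and those of h at most [be]
   D^i. *)
pose al := A * D ^+ K / normc (tcoef (val f) K).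
pose be := B * D ^+ K.
have al0 : 0 <= al by rewrite /al !mulr_ge0 ?exprn_ge0 ?invr_ge0 ?normc_ge0.
have be0 : 0 <= be by rewrite /be mulr_ge0 ?exprn_ge0.
have fal i : normc (tcoef (val f) (K + i)) <= al * normc (tcoef (val f) K) * D ^+ i.
  by rewrite /al divfK ?gt_eqF// -mulrA -exprD.
(* Dividing the germ of h by that of f, one power of J f at a time. *)
have remainder N : exists r : expC R, [/\ M (h - r),
    forall n, (n < K + N)%N -> tcoef (val r) n = 0 &
    forall i, normc (tcoef (val r) (K + N + i)) <= be * ((1 + al) * D) ^+ N * D ^+ i].
  elim: N => [|N [r [Mr rlow rb]]].
    exists h; rewrite subrr; split => // [n|i]; rewrite addn0; first exact: hlow.
    by rewrite expr0 mulr1 /be -mulrA -exprD.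
  have [g [Mg glow gE]] := iterJ N.
  (* The next coefficient of the quotient: J^N f has leading term f_K at index K + N, so subtracting
     p J^N f kills the leading term of r. *)
  pose p := tcoef (val r) (K + N) / tcoef (val f) K.
  exists (r + (- p) *: g); split.
  - have -> : h - (r + (- p) *: g) = p *: g + (h - r).
      by rewrite scaleNr opprB addrCA.
    exact: Mlin.
  - move=> n; rewrite addnS ltnS leq_eqVlt tcoefD => /orP[/eqP ->|nKN].
      by rewrite [in X in _ + X]addnC gE /p mulNr divfK// subrr.
    rewrite rlow// add0r; case: (ltnP n N) => [/glow ->|Nn]; first by rewrite mulr0.
    rewrite -(subnKC Nn) gE Mlow ?mulr0//.
    by rewrite ltn_subLR// addnC.
  - move=> i; rewrite tcoefD addnS addSnnS.
    rewrite [X in _ + - p * tcoef _ X](_ : _ = N + (K + i.+1))%N; last by rewrite addnCA addnA.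
    rewrite gE; apply: (le_trans (le_normcD _ _)); rewrite normcM normcN.
    have pb : normc p * normc (tcoef (val f) K) <= be * ((1 + al) * D) ^+ N.
      have := rb 0%N; rewrite addn0 mulr1 /p normcM normcV divfK ?gt_eqF//.
    (* The old coefficient accounts for the 1 and the subtracted one for the [al] in 1 + [al]; the
       extra D comes from the index moving from K + N + i to K + N + i + 1. *)
    have -> : be * ((1 + al) * D) ^+ N.+1 * D ^+ i =
        be * ((1 + al) * D) ^+ N * D ^+ i.+1 +
        al * (be * ((1 + al) * D) ^+ N) * D ^+ i.+1 by rewrite !exprS; ring.
    apply: lerD; first exact: rb.
    apply: (@le_trans _ _ (al * (normc p * normc (tcoef (val f) K)) * D ^+ i.+1)).
      rewrite [al * _]mulrCA -mulrA ler_wpM2l ?normc_ge0//; exact: fal.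
    by rewrite ler_wpM2r ?exprn_ge0// ler_wpM2l.
(* The factor 2 creates the decay: ((1 + [al]) D)^N = 2^-N Q^N, and the order K + N of the remainder
   supplies Q^N. From Q >= D and Q >= 1 one absorbs D^i and inserts Q^K. *)
pose Q := 2 * ((1 + al) * D).
have al1 : 1 <= 1 + al by rewrite lerDl.
have alD : D <= (1 + al) * D by rewrite ler_peMl.
have QD : D <= Q by rewrite /Q; lra.
have Q1 : 1 <= Q by apply: le_trans QD.
have Q0 := le_trans ler01 Q1.
apply: (@expC_closure _ _ _ Q) => // e e0.
have [N HN] : exists N, be * (2^-1) ^+ N <= e.
  have := @cvg_geometric R be 2^-1.
  rewrite ger0_norm ?invr_ge0// invf_lt1// ltr1n => /(_ isT)/cvgrPdist_lt/(_ _ e0).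
  move=> [N _ /(_ N (leqnn N))]; rewrite /= sub0r normrN => H; exists N.
  exact: le_trans (ler_norm _) (ltW H).
have [r [Mr rlow rb]] := remainder N; exists r => // z.
have [A' [D' [_ _ ra]]] := expC_egf r.
have rQ : coef_bounded (tcoef (val r)) e Q.
  move=> n; case: (ltnP n (K + N)) => [/rlow ->|].
    by rewrite normc0; apply: mulr_ge0; [exact: ltW|exact: exprn_ge0].
  move=> /subnKC <-; move: (n - (K + N))%N => i; apply: (le_trans (rb i)).
  apply: (@le_trans _ _ (be * 2^-1 ^+ N * Q ^+ (K + N + i))); last first.
    by rewrite ler_wpM2r ?exprn_ge0.
  have QN : Q ^+ N = 2 ^+ N * ((1 + al) * D) ^+ N by exact: exprMn.
  rewrite !exprD QN.
  have -> : be * 2^-1 ^+ N * (Q ^+ K * (2 ^+ N * ((1 + al) * D) ^+ N) * Q ^+ i) =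
     Q ^+ K * (be * ((1 + al) * D) ^+ N * Q ^+ i).
    by rewrite exprVn; field; rewrite expf_neq0// pnatr_eq0.
  have be1 : 0 <= be * ((1 + al) * D) ^+ N.
    by rewrite mulr_ge0// exprn_ge0// (le_trans D_ge0).
  apply: (@le_trans _ _ (be * ((1 + al) * D) ^+ N * Q ^+ i)).
    by rewrite ler_wpM2l// lerXn2r.
  by rewrite ler_peMl ?exprn_ege1// mulr_ge0// exprn_ge0.
exact: (egf_bound rQ Q0 ra).
Qed.
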